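(* Let $\{\overline{\Gamma}_m,\ m\in\mathcal M\}$ be an at most countable family of classes of measurable functions from $\mathscr W$ to $I$ such that, for each $m\in\mathcal M$, $\overline{\Gamma}_m$ is VC-subgraph on $\mathscr W$ with dimension not larger than $V_m\ge 1$. For each $m$ let $\Gamma_m$ be a finite or countable subset of $\overline{\Gamma}_m$, and let $\Delta:\mathcal M\to\mathbb R_+$ satisfy $\Sigma=\sum_{m\in\mathcal M}e^{-\Delta(m)}<+\infty$. Set $\mathbf Q_m=\{\mathbf R_\gamma,\ \gamma\in\Gamma_m\}$ and $\Xi(m)=D_n(m)/4.7+\Delta(m)$ for all $m\in\mathcal M$. Then, whatever the conditional probabilities $\mathbf R^\star=(R_1^\star,\ldots,R_n^\star)$ of the $Y_i$ given $W_i$ and whatever the distributions of the $W_i$, the estimator $\mathbf R_{\widehat\gamma}$ given by the model selection procedure described in the context satisfies, for any $\xi>0$, with probability at least $1-\Sigma e^{-\xi}$, $$\mathbf h^2(\mathbf R^\star,\mathbf R_{\widehat\gamma})\le\inf_{m\in\mathcal M}\left[c_1\mathbf h^2(\mathbf R^\star,\mathbf Q_m)+c_2\left(\Xi(m)+1.49+\xi\right)\right],$$ where $c_1=149.8$ and $c_2=5013.2$.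
   Context: **Observations.** $X_i=(W_i,Y_i)$, $i=1,\dots,n$, are independent random variables with values in a measurable product space $(\mathscr W\times\mathscr Y,\mathcal W\otimes\mathcal Y)$; $\boldsymbol X=(X_1,\ldots,X_n)$. The conditional distribution of $Y_i$ given $W_i$ is $R_i^\star(W_i)$, where $R_i^\star$ is a measurable map from $(\mathscr W,\mathcal W)$ to the set of all probabilities on $(\mathscr Y,\mathcal Y)$ equipped with the Borel $\sigma$-algebra associated with the Hellinger distance. $P_{W_i}$ is the distribution of $W_i$. **Exponential family.** $I\subset\mathbb R$ is an interval with non-empty interior, $(\mathscr Y,\mathcal Y,\mu)$ a measured space, $a\ge 0$ a function on $\mathscr Y$, $\nu=a\cdot\mu$, $T$ a real-valued measurable function on $\mathscr Y$ which is not $\nu$-a.e. constant, $u$ a continuous strictly monotone function on $I$, and for $\gamma\in I$, $y\in\mathscr Y$: $r_\gamma(y)=e^{u(\gamma)T(y)-B(\gamma)}$, $B(\gamma)=\log\left[\int_{\mathscr Y}e^{u(\gamma)T(y)}d\nu(y)\right]$ (assumed finite). $R_\gamma=r_\gamma\cdot\nu$ is a probability on $\mathscr Y$. For $\gamma:\mathscr W\to I$ measurable, $R_\gamma$ also denotes the map $w\mapsto R_{\gamma(w)}$ and $\mathbf R_\gamma=(R_\gamma,\ldots,R_\gamma)$ ($n$ entries). **Loss.** The Hellinger distance is $h(P,Q)=\left[\frac12\int(\sqrt p-\sqrt q)^2d\mu\right]^{1/2}$ for $P=p\cdot\mu$, $Q=q\cdot\mu$. For $n$-tuples $\mathbf R=(R_1,\ldots,R_n)$,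 $\mathbf R'=(R_1',\ldots,R_n')$ of measurable maps from $\mathscr W$ to probabilities on $\mathscr Y$, $\mathbf h^2(\mathbf R,\mathbf R')=\sum_{i=1}^n\int_{\mathscr W}h^2(R_i(w),R_i'(w))dP_{W_i}(w)$, and $\mathbf h^2(\mathbf R,\mathbf A)=\inf_{\mathbf R'\in\mathbf A}\mathbf h^2(\mathbf R,\mathbf R')$ for a set $\mathbf A$. In $\mathbf h^2(\mathbf R^\star,\mathbf R_{\widehat\gamma})$ the (random) function $\widehat\gamma$ is held fixed in the integrals. **VC-subgraph.** A class $\mathcal F$ of real functions on $\mathscr W$ is VC-subgraph with dimension not larger than $V$ if for every finite $\mathcal S\subset\mathscr W\times\mathbb R$ with $|\mathcal S|=V+1$ there is a subset of $\mathcal S$ that is not of the form $\mathcal S\cap\{(w,t):t<f(w)\}$ for any $f\in\mathcal F$. **Estimation procedure.** Put $\Gamma=\cup_{m\in\mathcal M}\Gamma_m$; $\psi(x)=(x-1)/(x+1)$ for $x\in[0,+\infty)$ and $\psi(+\infty)=1$; for $\gamma,\gamma'\in\Gamma$, $$\mathbf T(\boldsymbol X,\gamma,\gamma')=\sum_{i=1}^n\psi\left(\sqrt{r_{\gamma'(W_i)}(Y_i)/r_{\gamma(W_i)}(Y_i)}\right)$$ with conventions $0/0=1$, $c/0=+\infty$ for $c>0$; $D_n(m)=10^3V_m\left[9.11+\log_+(n/V_m)\right]$ with $\log_+x=\max(0,\log x)$; $$\mathrm{pen}(\gamma)=10^2\inf_{\{m\in\mathcal M:\gamma\in\Gamma_m\}}\left[D_n(m)+4.7\Delta(m)\right],\qquad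 \upsilon(\boldsymbol X,\gamma)=\sup_{\gamma'\in\Gamma}\left[\mathbf T(\boldsymbol X,\gamma,\gamma')-\mathrm{pen}(\gamma')\right]+\mathrm{pen}(\gamma).$$ The estimator $\widehat\gamma=\widehat\gamma(\boldsymbol X)$ is any measurable element of the set $\{\gamma\in\Gamma:\upsilon(\boldsymbol X,\gamma)\le\inf_{\gamma'\in\Gamma}\upsilon(\boldsymbol X,\gamma')+1\}$. *)

(* Defs.v *)
From HB Require Import structures.
From mathcomp Require Import all_boot all_order all_algebra.
From mathcomp Require Import all_classical all_reals all_analysis.
From mathcomp Require Import measurable_realfun.

Set Implicit Arguments.
Unset Strict Implicit.
Unset Printing Implicit Defensive.

Import Order.TTheory GRing.Theory Num.Theory.
Import numFieldNormedType.Exports.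

Local Open Scope classical_set_scope.
Local Open Scope ring_scope.

(* The measure f . mu; the two proofs are arguments so that it is canonically
   a measure. *)
Definition density d (T : measurableType d) (R : realType)
    (mu : {measure set T -> \bar R}) (f : T -> R)
    (f0 : forall x, 0 <= f x) (mf : measurable_fun setT f) (A : set T) : \bar R :=
  (\int[mu]_(x in A) (f x)%:E)%E.

Section density_measure.
Import HBNNSimple.
Local Open Scope ereal_scope.
Context d (T : measurableType d) (R : realType).
Variables (mu : {measure set T -> \bar R}) (f : T -> R).
Variables (f0 : forall x, (0 <= f x)%R) (mf : measurable_fun setT f).

Local Notation fmu := (density mu f0 mf).

Let density0 : fmu set0 = 0.
Proof. by rewrite /density integral_set0. Qed.

Let density_ge0 A : 0 <= fmu A.
Proof. by apply: integral_ge0 => x _; rewrite lee_fin. Qed.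

Let density_sigma_additive : semi_sigma_additive fmu.
Proof.
move=> F mF tF mUF; rewrite /density ge0_integral_bigcup//.
- apply: is_cvg_ereal_nneg_natsum => n _.
  by apply: integral_ge0 => x _; rewrite lee_fin.
- by apply/measurable_EFinP; exact: measurable_funTS.
- by move=> x _; rewrite lee_fin.
Qed.

HB.instance Definition _ := isMeasure.Build _ _ _ fmu
  density0 density_ge0 density_sigma_additive.

Lemma ge0_integral_density (h : T -> \bar R) E : (forall x, 0 <= h x) ->
    measurable E -> measurable_fun E h ->
  \int[fmu]_(x in E) h x = \int[mu]_(x in E) (h x * (f x)%:E).
Proof.
move=> h0 mE mh; pose k := nnsfun_approx mE mh.
have mfE : measurable_fun E (EFin \o f).
  by apply/measurable_EFinP; exact: measurable_funTS.
have -> : \int[fmu]_(x in E) h x =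
    lim (\int[fmu]_(x in E) (EFin \o k n) x @[n --> \oo]).
  have hE x : E x -> h x = lim ((EFin \o k n) x @[n --> \oo]).
    by move=> Ex; apply/esym/cvg_lim => //; exact: cvg_nnsfun_approx.
  under eq_integral => x /[!inE] /hE -> //.
  apply: monotone_convergence => //.
  - by move=> n; apply/measurable_EFinP; exact: measurable_funTS.
  - by move=> n x Ex //=; rewrite lee_fin.
  - by move=> x Ex a b ab; rewrite lee_fin; exact/lefP/nd_nnsfun_approx.
have -> : \int[mu]_(x in E) (h x * (f x)%:E) =
    lim (\int[mu]_(x in E) ((EFin \o k n) x * (f x)%:E) @[n --> \oo]).
  have hE x : E x -> h x * (f x)%:E =
      lim ((EFin \o k n) x * (f x)%:E @[n --> \oo]).
    by move=> Ex; apply/esym/cvg_lim => //; apply: cvgeZr => //;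
      exact: cvg_nnsfun_approx.
  under eq_integral => x /[!inE] /hE -> //.
  apply: monotone_convergence => //.
  - move=> n; apply: emeasurable_funM => //.
    by apply/measurable_EFinP; exact: measurable_funTS.
  - by move=> n x Ex /=; rewrite mule_ge0 ?lee_fin.
  - move=> x Ex a b ab /=; rewrite lee_wpmul2r ?lee_fin//.
    exact/lefP/nd_nnsfun_approx.
suff suf n : \int[fmu]_(x in E) (EFin \o k n) x =
    \int[mu]_(x in E) ((EFin \o k n) x * (f x)%:E).
  by under eq_fun do rewrite suf.
have -> : \int[fmu]_(x in E) (EFin \o k n) x = \int[fmu]_(x in E)
    (\sum_(y \in range (k n)) (y * \1_(k n @^-1` [set y]) x)%:E).
  by apply: eq_integral => t tE; rewrite /= fimfunE -fsumEFin.
have indich r : measurable_fun E (fun x => (r * \1_(k n @^-1` [set r]) x)%:E).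
  by apply: (measurable_comp measurableT) => //; exact: measurable_funM.
rewrite ge0_integral_fsum//; last by move=> y x _; exact: nnfun_muleindic_ge0.
have -> : \int[mu]_(x in E) ((EFin \o k n) x * (f x)%:E) =
  \int[mu]_(x in E) (\sum_(y \in range (k n))
    (y * \1_(k n @^-1` [set y]) x)%:E * (f x)%:E).
  apply: eq_integral => x xE.
  rewrite -ge0_mule_fsuml => [|y]; last exact: nnfun_muleindic_ge0.
  by rewrite fsumEFin // -(fimfunE _ x).
rewrite ge0_integral_fsum//; last 2 first.
  - by move=> y; apply: emeasurable_funM.
  - by move=> y x Ex; apply: mule_ge0; [exact: nnfun_muleindic_ge0|rewrite lee_fin].
apply: eq_fsbigr => r rhn.
under eq_integral do rewrite EFinM.
rewrite integralZl_indic_nnsfun => //.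
under [RHS]eq_integral do rewrite EFinM -muleA.
rewrite ge0_integralZl//.
- rewrite integral_indic// /density setIC.
  under [in RHS]eq_integral do rewrite muleC.
  rewrite [in RHS](eq_integral ((EFin \o f) \_ (k n @^-1` [set r]))).
    by rewrite -integral_mkcondr.
  by move=> x xE; rewrite epatch_indic.
- by apply: emeasurable_funM => //; exact/measurable_EFinP.
- by move=> t Et; rewrite mule_ge0 ?lee_fin.
- by move: rhn; rewrite inE => -[t _ <-]; rewrite lee_fin.
Qed.

Lemma integral_density (h : T -> \bar R) E : measurable E ->
    measurable_fun E h ->
  \int[fmu]_(x in E) h x = \int[mu]_(x in E) (h x * (f x)%:E).
Proof.
move=> mE mh; rewrite [LHS]integralE [RHS]integralE.
rewrite !ge0_integral_density//; [|exact: measurable_funeneg|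
  exact: measurable_funepos].
congr (_ - _); apply: eq_integral => x _.
- rewrite !funeposE; have [h0|h0] := leP 0 (h x).
    by rewrite !max_l// mule_ge0// lee_fin.
  by rewrite !max_r ?mul0e ?mule_le0_ge0 ?lee_fin// ltW.
- rewrite !funenegE; have [h0|h0] := leP 0 (h x).
    by rewrite !max_r ?mul0e ?oppe_le0 ?mule_ge0 ?lee_fin.
  by rewrite !max_l ?muleN ?mulNe ?oppe_ge0 ?mule_le0_ge0 ?lee_fin// ltW.
Qed.

End density_measure.

Section exponential_family.
Context d (Y : measurableType d) (R : realType).
Variables (nu : {measure set Y -> \bar R}) (T : {mfun Y >-> R}) (u : R -> R).

Definition log_partition (g : R) : \bar R :=
  lne (\int[nu]_y (expR (u g * T y))%:E)%E.

Definition exp_density (g : R) (y : Y) : R :=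
  expR (u g * T y - fine (log_partition g)).

Lemma exp_density_ge0 g y : 0 <= exp_density g y.
Proof. exact: expR_ge0. Qed.

Lemma measurable_exp_density g : measurable_fun setT (exp_density g).
Proof.
apply: measurableT_comp => //; apply: measurable_funB => //.
exact: measurable_funM.
Qed.

(* exp_density g . nu, bundled as a probability: mnormalize does nothing when
   log_partition g is finite (exp_probE below). *)
Definition exp_prob (g : R) : probability Y R :=
  mnormalize (density nu (exp_density_ge0 g) (measurable_exp_density g)) point.

Lemma exp_probE g : log_partition g \is a fin_num ->
  forall A, exp_prob g A = (\int[nu]_(y in A) (exp_density g y)%:E)%E.
Proof.
move=> Bfin A; rewrite /exp_prob/= /mnormalize/=.
suff E : density nu (exp_density_ge0 g) (measurable_exp_density g) setT = 1%E.
  by rewrite E onee_eq0/= invr1 mule1.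
rewrite /density /exp_density.
have mE : measurable_fun setT (fun y => (expR (u g * T y))%:E).
  apply/measurable_EFinP; apply: measurableT_comp => //.
  exact: measurable_funM.
under eq_integral do rewrite expRD EFinM muleC.
rewrite ge0_integralZl// ?lee_fin ?expR_ge0//.
move: Bfin; rewrite /log_partition.
case: (integral _ _ _) => [r| |] //=.
case: ifPn => //=; rewrite -ltNge => r0 _.
by rewrite -EFinM expRN lnK ?posrE// mulVf// gt_eqF.
Qed.

End exponential_family.

Section hellinger.
Context d (Y : measurableType d) (R : realType).
Implicit Types P Q : probability Y R.

Definition measure_sum P Q : set Y -> \bar R := measure_add P Q.

HB.instance Definition _ P Q := Measure.on (measure_sum P Q).

Let measure_sum_fin P Q : fin_num_fun (measure_sum P Q).
Proof.
move=> A mA; rewrite /measure_sum measure_addE fin_numD.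
by rewrite !fin_num_measure.
Qed.

HB.instance Definition _ P Q :=
  Measure_isFinite.Build _ _ _ (measure_sum P Q) (@measure_sum_fin P Q).

(* P and Q are arbitrary, so the common dominating measure is taken to be P + Q;
   hellingerE below gives the value for any other one. *)
Definition hellinger P Q : R :=
  let m := measure_sum P Q in
  let p y := fine (Radon_Nikodym (charge_of_finite_measure P) m y) in
  let q y := fine (Radon_Nikodym (charge_of_finite_measure Q) m y) in
  Num.sqrt (2^-1 * \int[m]_y (Num.sqrt (p y) - Num.sqrt (q y)) ^+ 2).

Lemma hellingerE P Q (m : {measure set Y -> \bar R}) (p q : Y -> R)
    (p0 : forall y, 0 <= p y) (mp : measurable_fun setT p)
    (q0 : forall y, 0 <= q y) (mq : measurable_fun setT q) :
    (forall A, measurable A -> P A = density m p0 mp A) ->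
    (forall A, measurable A -> Q A = density m q0 mq A) ->
  hellinger P Q =
  Num.sqrt (2^-1 * \int[m]_y (Num.sqrt (p y) - Num.sqrt (q y)) ^+ 2).
Proof.
move=> Pp Qq; rewrite /hellinger.
set s := measure_sum P Q.
set dP := Radon_Nikodym _ _; set dQ := Radon_Nikodym _ _.
pose k y := p y + q y.
have k0 y : 0 <= k y by rewrite addr_ge0.
have mk : measurable_fun setT k by exact: measurable_funD.
have sE A : measurable A -> s A = density m k0 mk A.
  move=> mA; transitivity (P A + Q A)%E; first exact: measure_addE.
  rewrite Pp// Qq// /density.
  rewrite -ge0_integralD//; [by move=> y _; rewrite lee_fin| |
    by move=> y _; rewrite lee_fin|].
  - by apply/measurable_EFinP; exact: measurable_funTS.
  - by apply/measurable_EFinP; exact: measurable_funTS.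
have RN (N : probability Y R) (f : Y -> R) (f0 : forall y, 0 <= f y)
    (mf : measurable_fun setT f) :
    (forall A, measurable A -> (N A <= s A)%E) ->
    (forall A, measurable A -> N A = density m f0 mf A) ->
    let dN := Radon_Nikodym (charge_of_finite_measure N) s in
    measurable_fun setT dN /\
    ae_eq m setT (EFin \o f) (fun y => (fine (dN y) * k y)%:E).
  move=> Ns Nf dN.
  have dom : charge_of_finite_measure N `<< s.
    apply/null_content_dominatesP => A mA sA0.
    by apply/eqP; rewrite -measure_le0 -sA0 Ns.
  have mdN : measurable_fun setT dN.
    exact: measurable_int (Radon_Nikodym_integrable dom).
  split => //.
  apply: integral_ae_eq => //.
  - apply/integrableP; split; first exact/measurable_EFinP.
    under eq_integral do rewrite /= ger0_norm//.
    by rewrite -/(density m f0 mf setT) -Nf// probability_setT ltry.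
  - apply/measurable_EFinP; apply: measurable_funM => //.
    exact: measurableT_comp.
  move=> A _ mA; rewrite -/(density m f0 mf A) -Nf//.
  transitivity (\int[density m k0 mk]_(y in A) dN y)%E.
    transitivity (\int[s]_(y in A) dN y)%E; 
      first exact: (Radon_Nikodym_integral dom mA).
    by apply: eq_measure_integral => B mB _; exact: sE.
  rewrite integral_density//; last exact: measurable_funTS.
  apply: eq_integral => y _.
  by rewrite EFinM fineK// Radon_Nikodym_fin_num.
have sPQ A : s A = (P A + Q A)%E by exact: measure_addE.
have Ps A : measurable A -> (P A <= s A)%E by rewrite sPQ leeDl.
have Qs A : measurable A -> (Q A <= s A)%E by rewrite sPQ leeDr.
have [mdP Pae] := RN P p p0 mp Ps Pp.
have [mdQ Qae] := RN Q q q0 mq Qs Qq.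
congr (Num.sqrt (_ * _)); congr fine.
pose G y := (Num.sqrt (fine (dP y)) - Num.sqrt (fine (dQ y))) ^+ 2.
have msqrt (f : Y -> R) : measurable_fun setT f ->
    measurable_fun setT (fun y => Num.sqrt (f y)).
  move=> mf; apply: (measurableT_comp _ mf).
  by apply: continuous_measurable_fun => x; exact: sqrt_continuous.
have mG : measurable_fun setT (EFin \o G).
  apply/measurable_EFinP; apply: measurable_funX; apply: measurable_funB;
    by apply: msqrt; exact: measurableT_comp.
transitivity (\int[density m k0 mk]_y (G y)%:E)%E.
  by apply: eq_measure_integral => B mB _; exact: sE.
rewrite integral_density//; apply: ge0_ae_eq_integral => //.
- by apply: emeasurable_funM => //; exact/measurable_EFinP.
- apply/measurable_EFinP; apply: measurable_funX; apply: measurable_funB;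
    exact: msqrt.
- by move=> y _; rewrite mule_ge0 ?lee_fin ?sqr_ge0.
- by move=> y _; rewrite lee_fin sqr_ge0.
apply: filterS2 Pae Qae => y /(_ I) [->] /(_ I) [->] _.
have sqrtk z : Num.sqrt (z * k y) = Num.sqrt z * Num.sqrt (k y).
  by rewrite mulrC sqrtrM// mulrC.
by rewrite !sqrtk -mulrBl exprMn sqr_sqrtr.
Qed.

Definition hellinger_open (U : set (probability Y R)) :=
  forall P, U P ->
    exists2 e, 0 < e & forall Q, hellinger P Q < e -> U Q.

(* Measurability of a map into the probabilities on Y, for the Borel sigma-algebra
   of the Hellinger distance. *)
Definition hellinger_measurable d' (W : measurableType d')
    (K : W -> probability Y R) :=
  forall U, <<s hellinger_open >> U -> measurable (K @^-1` U).

End hellinger.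

Section observations.
Context dO (Omega : measurableType dO) (R : realType) (P : probability Omega R).

Definition mutually_independent d (T : measurableType d) (I : finType)
    (X : I -> Omega -> T) :=
  forall (J : {set I}) (B : I -> set T), (forall i, measurable (B i)) ->
    P (\bigcap_(i in [set` J]) (X i @^-1` B i)) =
    (\prod_(i in J) P (X i @^-1` B i))%E.

(* K (W) is the conditional distribution of Y given W, characterized through the
   joint law of (W, Y); the measurability of K ^~ B is not repeated here, as it
   follows from hellinger_measurable K. *)
Definition conditional_distribution dW (TW : measurableType dW)
    dY (TY : measurableType dY) (Y : {RV P >-> TY}) (W : {RV P >-> TW})
    (K : TW -> probability TY R) :=
  forall A B, measurable A -> measurable B ->
    P (W @^-1` A `&` Y @^-1` B) = (\int[distribution P W]_(w in A) K w B)%E.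

End observations.

Section loss.
Context dW (TW : measurableType dW) dY (TY : measurableType dY) (R : realType).
Variables (n : nat) (PW : 'I_n -> probability TW R).
Local Open Scope ereal_scope.

Definition loss (K L : 'I_n -> TW -> probability TY R) : \bar R :=
  \sum_(i < n) \int[PW i]_w ((hellinger (K i w) (L i w)) ^+ 2)%:E.

Definition loss_set (K : 'I_n -> TW -> probability TY R)
    (A : set ('I_n -> TW -> probability TY R)) : \bar R :=
  ereal_inf [set loss K L | L in A].

End loss.

(* F is VC-subgraph with dimension not larger than V. *)
Definition vc_subgraph (W : Type) (R : realType) (F : set (W -> R)) (V : nat) :=
  forall S : set (W * R), (S #= `I_V.+1)%card ->
    exists2 A, A `<=` S &
      forall f, F f -> A <> S `&` [set wt | wt.2 < f wt.1].

Section selection.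
Context (R : realType).

Definition psi (x : \bar R) : R :=
  match x with
  | x%:E => (x - 1) / (x + 1)
  | +oo%E => 1
  | -oo%E => 0 (* never used: psi is applied to nonnegative arguments *)
  end.

(* x / y for x, y >= 0, with 0 / 0 = 1 and x / 0 = +oo if x > 0. *)
Definition ratio (x y : R) : \bar R :=
  if y == 0 then (if x == 0 then 1%E else +oo%E) else (x / y)%:E.

Definition logp (x : R) : R := Num.max 0 (ln x).

Definition dimension_term (n V : nat) : R :=
  10 ^+ 3 * V%:R * (911 / 100 + logp (n%:R / V%:R)).

Variables (W Y : Type) (r : R -> Y -> R) (n : nat).
Variables (M : Type) (Gamma : M -> set (W -> R)) (V : M -> nat) (Delta : M -> R).

Definition test_statistic (x : n.-tuple (W * Y)) (g g' : W -> R) : R :=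
  \sum_(i < n) let: (w, y) := tnth x i in
    psi (er_map Num.sqrt (ratio (r (g' w) y) (r (g w) y))).

Definition penalty (g : W -> R) : \bar R :=
  ((10 ^+ 2)%:E * ereal_inf [set (dimension_term n (V m) + 47 / 10 * Delta m)%:E
                             | m in [set m | Gamma m g]])%E.

Definition models : set (W -> R) := \bigcup_m Gamma m.

Definition upsilon (x : n.-tuple (W * Y)) (g : W -> R) : \bar R :=
  (ereal_sup [set (test_statistic x g g')%:E - penalty g' | g' in models]
   + penalty g)%E.

Definition estimators (x : n.-tuple (W * Y)) : set (W -> R) :=
  [set g | models g /\
    (upsilon x g <= ereal_inf [set upsilon x g' | g' in models] + 1)%E].

End selection.

(* Main.v *)
(* Fix gbar in a model m0 and write f_g = psi (sqrt (r_g / r_gbar)), a function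
   with values in [-1, 1]. A pointwise quadratic inequality between square roots
   of densities gives, for every law S and with Q = R_gbar, Q' = R_g,
     int (f_g + f_g^2 / 10) dS + (47/250) h^2(S, Q') <= 14 h^2(S, Q),
   so that T(X, gbar, g) is at most 14 h^2(R*, R_gbar) - (47/250) h^2(R*, R_g)
   plus the deviation sum_i (f_g(X_i) - E (f_g + f_g^2 / 10)(X_i)).

   This one-sided deviation is bounded uniformly over a model without any
   chaining. By Jensen, exp of one hundredth of it is at most the expectation,
   over a ghost sample X', of the product of exp ((a - b - b^2 / 10) / 100) with
   a = f_g(X_i), b = f_g(X'_i), and averaging over the exchange of a and b makes
   each factor at most 1. Symmetrizing one coordinate at a time thus bounds the
   expected maximum over g by the number of traces of the f_g on 2n points, up
   to an error absorbed by the closeness of the f_g sharing a trace. Since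
   g |-> f_g (w, y) is quasiconcave on I, its superlevel sets are intervals, and
   the Sauer-Shelah lemma for the subgraphs bounds the number of traces.

   A union bound over m weighted by exp (- Delta m), and the definition of the
   estimator, bound the risk for a fixed gbar. The bound to be minimized over
   m and gbar is deterministic, so the infimum follows by continuity of P along
   decreasing events. The value 47/250 is such that 47/250 * 149.8 >= 28 and
   47/250 * 5013.2 >= 2 * 100 * 4.7. *)

From HB Require Import structures.
Require Import Defs.
From mathcomp Require Import all_boot all_order all_algebra.

Set Implicit Arguments.
Unset Strict Implicit.
Unset Printing Implicit Defensive.

(** * Vapnik-Chervonenkis classes *)

Definition shatters (T : finType) (F : {set {set T}}) (D : {set T}) :=
  [forall B : {set T}, (B \subset D) ==> [exists A in F, A :&: D == B]].

Lemma shattersP (T : finType) (F : {set {set T}}) (D : {set T}) :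
  reflect (forall B : {set T}, B \subset D -> exists2 A, A \in F & A :&: D = B)
          (shatters F D).
Proof.
apply: (iffP forallP) => [h B BD|h B].
  have /implyP/(_ BD)/existsP[A /andP[AF /eqP AB]] := h B.
  by exists A.
apply/implyP => /h[A AF AB]; apply/existsP; exists A.
by rewrite AF AB eqxx.
Qed.

Lemma shatters_subset (T : finType) (F : {set {set T}}) (D D' : {set T}) :
  D' \subset D -> shatters F D -> shatters F D'.
Proof.
move=> D'D /shattersP h; apply/shattersP => B BD'.
have [A AF AB] := h B (subset_trans BD' D'D).
exists A => //; rewrite -(setIidPr D'D) setIA AB; exact/setIidPl.
Qed.

(* Pajor's form of the Sauer-Shelah lemma. *)
Lemma card_le_shattered (T : finType) (F : {set {set T}}) :
  (#|F| <= #|[set D | shatters F D]|)%N.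
Proof.
elim: {F}_.+1 {-2}F (ltnSn #|F|) => // k IH F; rewrite ltnS => Fk.
have [F1|] := leqP #|F| 1.
  have [/eqP->//|F0] := boolP (#|F| == 0%N).
  (* A nonempty family shatters at least the empty set. *)
  apply: (leq_trans F1); rewrite card_gt0; apply/set0Pn; exists set0.
  rewrite inE; apply/shattersP => B; rewrite subset0 => /eqP ->.
  have /card_gt0P[A AF] : (0 < #|F|)%N by rewrite lt0n.
  by exists A => //; rewrite setI0.
move=> /card_gt1P[A1 [A2 [A1F A2F A12]]].
have [x xA] : exists x, (x \in A1) != (x \in A2).
  apply/existsP; apply: contraNT A12 => /existsPn h.
  by apply/eqP/setP => x; have /negPn/eqP := h x.
(* Both halves are nonempty, hence strictly smaller than [F], and the induction applies to each. *)
pose F0 := [set A in F | x \notin A]; pose F1 := [set A in F | x \in A].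
have FE : (#|F| = #|F0| + #|F1|)%N.
  rewrite -cardsUI -[LHS]addn0; congr (_ + _)%N.
    by apply: eq_card => A; rewrite !inE -andb_orr orNb andbT.
  apply/esym/eqP; rewrite cards_eq0; apply/eqP/setP => A; rewrite !inE.
  by case: (x \in A); rewrite ?andbF.
have F0_gt0 : (0 < #|F0|)%N.
  apply/card_gt0P; case xA1: (x \in A1) xA => xA.
    by exists A2; rewrite !inE A2F; case: (x \in A2) xA.
  by exists A1; rewrite !inE A1F xA1.
have F1_gt0 : (0 < #|F1|)%N.
  apply/card_gt0P; case xA1: (x \in A1) xA => xA.
    by exists A1; rewrite !inE A1F xA1.
  by exists A2; rewrite !inE A2F; case: (x \in A2) xA.
set S0 := [set D | shatters F0 D]; set S1 := [set D | shatters F1 D].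
have h0 : (#|F0| <= #|S0|)%N.
  by apply: IH; apply: leq_trans Fk; rewrite FE -addn1 leq_add2l.
have h1 : (#|F1| <= #|S1|)%N.
  by apply: IH; apply: leq_trans Fk; rewrite FE -add1n leq_add2r.
have xS0 D : D \in S0 -> x \notin D.
  rewrite inE => /shattersP h; apply/negP => xD.
  have [A] := h D (subxx _); rewrite inE => /andP[_ xA'] /setP/(_ x).
  by rewrite !inE xD (negbTE xA').
have xS1 D : D \in S1 -> x \notin D.
  rewrite inE => /shattersP h; apply/negP => xD.
  have [A] := h set0 (sub0set _); rewrite inE => /andP[_ xA'] /setP/(_ x).
  by rewrite !inE xD xA'.
(* No set of [S0] or [S1] contains [x], so [S0 :|: S1] and the sets [x |: D] with [D] in [S0 :&: S1]
   form disjoint families of total size [#|S0| + #|S1|]. All are shattered by [F]: on [x |: D], a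
   trace containing [x] comes from [F1] and the others from [F0]. *)
have inj : {in S0 :&: S1 &, injective (fun D => x |: D)}.
  move=> D D'; rewrite !(inE, in_setI) => /andP[D0 _] /andP[D'0 _] /setP e.
  apply/setP => y; have := e y; rewrite !inE.
  have [->|//] := eqVneq y x.
  by rewrite (negbTE (xS0 D _)) ?inE// (negbTE (xS0 D' _)) ?inE.
rewrite FE (leq_trans (leq_add h0 h1))// -cardsUI -(card_in_imset inj).
rewrite -cardsUI [X in (_ + X)%N](_ : _ = 0%N) ?addn0; last first.
  apply/eqP; rewrite cards_eq0; apply/eqP/setP => D; rewrite !inE.
  apply/negP => /andP[] /orP D01 /imsetP[D' _ DE].
  have : x \in D by rewrite DE setU11.
  by apply/negP; case: D01 => ?; [apply: xS0|apply: xS1]; rewrite inE.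
apply: subset_leq_card; apply/subsetP => D; rewrite !inE => /orP[/orP[]|].
- move=> /shattersP h; apply/shattersP => B /h[A AF AB]; exists A => //.
  by move: AF; rewrite inE => /andP[].
- move=> /shattersP h; apply/shattersP => B /h[A AF AB]; exists A => //.
  by move: AF; rewrite inE => /andP[].
- move=> /imsetP[D']; rewrite !inE => /andP[/[dup] D'0 /shattersP s0 /shattersP s1] ->.
  have xD' : x \notin D' by apply: xS0; rewrite inE.
  apply/shattersP => B BD.
  have B'D' : B :\ x \subset D'.
    apply/subsetP => y; rewrite !inE => /andP[yx yB].
    by have := subsetP BD y yB; rewrite !inE (negbTE yx).
  have [xB|xB] := boolP (x \in B).
    have [A] := s1 _ B'D'; rewrite inE => /andP[AF Ax] AB; exists A => //.
    apply/setP => y; have /setP/(_ y) := AB; rewrite !inE.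
    by have [->|//] := eqVneq y x; rewrite Ax xB.
  have [A] := s0 _ B'D'; rewrite inE => /andP[AF Ax] AB; exists A => //.
  apply/setP => y; have /setP/(_ y) := AB; rewrite !inE.
  by have [->|//] := eqVneq y x; rewrite (negbTE Ax) (negbTE xB).
Qed.

(** A shattered set with more than [V] elements would contain a shattered one with exactly [V.+1];
    the sum counts the sets with at most [V] elements. *)
Lemma card_le_sum_bin (T : finType) (F : {set {set T}}) (V : nat) :
  (forall D : {set T}, #|D| = V.+1 -> ~~ shatters F D) ->
  (#|F| <= \sum_(i < V.+1) 'C(#|T|, i))%N.
Proof.
move=> h; apply: (leq_trans (card_le_shattered F)).
have -> : (\sum_(i < V.+1) 'C(#|T|, i))%N = #|[set D : {set T} | (#|D| < V.+1)%N]|.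
  rewrite -sum1_card (partition_big (fun D : {set T} => inord #|D| : 'I_V.+1) xpredT)//=.
  apply: eq_bigr => i _; rewrite -card_draws -sum1dep_card.
  apply: eq_bigl => D; rewrite inE; symmetry.
  apply/andP/eqP => [[DV /eqP <-]|Di]; first by rewrite inordK.
  have DV : (#|D| < V.+1)%N by rewrite Di.
  by split => //; apply/eqP/val_inj; rewrite /= inordK.
apply: subset_leq_card; apply/subsetP => D; rewrite !inE => sD.
rewrite ltnS leqNgt; apply/negP => VD.
have [D' D'D cD'] : exists2 D' : {set T}, D' \subset D & #|D'| = V.+1.
  have : (0 < #|[set B : {set T} | B \subset D & #|B| == V.+1]|)%N.
    by rewrite cards_draws bin_gt0.
  by move=> /card_gt0P[B]; rewrite inE => /andP[BD /eqP BV]; exists B.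
by have := h _ cD'; rewrite (shatters_subset D'D sD).
Qed.

From mathcomp Require Import all_classical all_reals all_analysis.
From mathcomp Require Import measurable_realfun ring lra.

Import Order.TTheory GRing.Theory Num.Theory.
Import numFieldNormedType.Exports.

Local Open Scope classical_set_scope.
Local Open Scope ring_scope.

(** Since [q ^+ V <= q ^+ i] for [i <= V], multiplying the sum by [q ^+ V] gives at most
    [(1 + q) ^+ N <= expR (q * N%:R)]. The parameter [q] is tuned in [vc_summax_le]. *)
Lemma sum_bin_le (R : realType) (N V : nat) (q : R) : 0 < q -> q <= 1 ->
  (\sum_(i < V.+1) 'C(N, i))%:R <= q ^- V * expR (q * N%:R).
Proof.
move=> q0 q1; rewrite mulrC ler_pdivlMr ?exprn_gt0//.
have -> : q * N%:R = N%:R * q by rewrite mulrC.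
rewrite expRM_natl.
apply: (@le_trans _ _ ((1 + q) ^+ N)); last first.
  by rewrite lerXn2r ?nnegrE ?expR_ge0 ?expR_ge1Dx// addr_ge0 ?ltW.
rewrite natr_sum mulr_suml.
apply: (@le_trans _ _ (\sum_(i < V.+1) ('C(N, i)%:R * q ^+ i))).
  apply: ler_sum => i _; rewrite ler_wpM2l ?ler0n//.
  by rewrite ler_wiXn2l ?(ltW q0)// -ltnS.
rewrite exprDn (eq_bigr (fun i : 'I_N.+1 => 'C(N, i)%:R * q ^+ i)); last first.
  by move=> i _; rewrite expr1n mul1r mulr_natl.
have nn i : 0 <= 'C(N, i)%:R * q ^+ i.
  by rewrite mulr_ge0 ?ler0n ?exprn_ge0 ?ltW.
pose a i := 'C(N, i)%:R * q ^+ i.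
rewrite -!(big_mkord xpredT a).
have [VN|NV] := leqP V N.
  rewrite [leRHS](@big_cat_nat _ _ _ V.+1) ?ltnS//= lerDl.
  by apply: sumr_ge0 => i _; exact: nn.
rewrite [leLHS](@big_cat_nat _ _ _ N.+1) ?ltnS ?(ltnW NV)//=.
rewrite [X in _ + X]big_nat [X in _ + X]big1 ?addr0// => i /andP[Ni _].
by rewrite /a bin_small ?mul0r.
Qed.

(* Distinct points of a shattered set of indices carry distinct points of
   W * R, so that the dimension also bounds the traces on families with
   repetitions. *)
Lemma vc_subgraph_traces (W : Type) (R : realType) (F : set (W -> R)) (V : nat)
    (J T : finType) (g : J -> W -> R) (p : T -> W * R) :
  vc_subgraph F V -> (forall j, F (g j)) ->
  (#|[set [set t | ((p t).2 < g j (p t).1)%R]%SET | j : J]%SET|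
     <= \sum_(i < V.+1) 'C(#|T|, i))%N.
Proof.
move=> vcF Fg; apply: card_le_sum_bin => D DV; apply/negP => /shattersP sD.
(* Two indices with the same image cannot be separated by a trace, whereas shattering realizes every
   singleton of [D]. *)
have pinj : {in D &, injective p}.
  move=> s t sD' tD' pst; apply/eqP; apply: contraT => st.
  have sBD : [set s]%SET \subset D by rewrite finset.sub1set.
  have [_ /imsetP[j _ ->] /setP e] := sD _ sBD.
  have := e s; have := e t; rewrite !inE sD' tD' !andbT eqxx eq_sym (negbTE st).
  by rewrite pst => ->.
have cS : ((p @` [set` D]) #= `I_V.+1)%card.
  have imp : {in [set` D] &, injective p} by move=> s t; rewrite !inE; exact: pinj.
  apply: card_eq_trans (inj_card_eq imp) _.
  have <- : [set enum_val i | i in [set: 'I_#|D|]] = [set` D].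
    apply/seteqP; split => [_ [i _ <-]|t tD]; first exact: enum_valP.
    by exists (enum_rank_in tD t) => //; rewrite enum_rankK_in.
  have ev : {in [set: 'I_#|D|] &, injective (@enum_val _ (mem D))}.
    by move=> i j _ _; exact: enum_val_inj.
  by apply: card_eq_trans (inj_card_eq ev) _; rewrite -DV card_eq_sym card_II.
(* The subset [A] that no subgraph cuts out is pulled back to [D], where shattering yields a [g j]
   cutting it out. *)
have [A AS /(_ _ (Fg _)) hA] := vcF _ cS.
have BD : [set t in D | p t \in A]%SET \subset D.
  by apply/fintype.subsetP => t; rewrite inE => /andP[].
have [_ /imsetP[j _ ->] /setP e] := sD _ BD.
apply: (hA j); apply/seteqP; split => [x xA|x].
  have [t tD tx] := AS _ xA; split; first by exists t.
  rewrite /= -tx; have := e t; rewrite !inE tD andbT => ->.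
  by rewrite tx; exact/mem_set.
move=> [[t tD <-]] /= lt.
have := e t; rewrite !inE lt tD /= => /esym ptA.
exact: set_mem.
Qed.

(** Among finitely many values, an order-convex condition is membership in some half-open interval
    []s.1, s.2]]. Both of its ends are tested through [s < x j], the only comparison that a subgraph
    records. *)
Lemma bracket (R : realType) (J : finType) (x : J -> R) (Q : R -> bool) :
  (forall i j k, x i <= x j <= x k -> Q (x i) -> Q (x k) -> Q (x j)) ->
  exists s : R * R, forall j, Q (x j) = (s.1 < x j) && ~~ (s.2 < x j).
Proof.
move=> Qx; have [[j0 Qj0]|noQ] := pselect (exists j, Q (x j)); last first.
  exists (0, 0) => j /=; rewrite andbN; apply/negP => Qj; apply: noQ.
  by exists j.
case: (@arg_minP _ _ _ j0 (fun j => Q (x j)) x Qj0) => a Qa amin.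
case: (@arg_maxP _ _ _ j0 (fun j => Q (x j)) x Qj0) => b Qb bmax.
(* The lower end must lie below the least good value [x a] but not below any smaller value;
   [x a - 1] serves when there is no smaller value. *)
pose lo := \big[Num.max/(x a - 1)]_(j | x j < x a) x j.
have loa : lo < x a by apply: bigmax_lt => //; rewrite ltrBlDr ltrDl.
exists (lo, x b) => j /=; rewrite -leNgt; apply/idP/andP => [Qj|[loj jb]].
  by split; [exact: lt_le_trans loa (amin _ Qj)|exact: bmax].
apply: (Qx a j b) => //; rewrite jb andbT leNgt; apply/negP => ja.
by move: loj; rewrite ltNge (@le_bigmax_cond _ _ _ _ _ (fun j => x j < x a)).
Qed.

(** The representative [rep j] depends only on [tr j], so [tr] is injective on the
    representatives. *)
Lemma transversal_exists (J U : finType) (tr : J -> U) :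
  exists2 D : {set J}, (#|D| <= #|[set tr j | j : J]%SET|)%N &
    forall j, exists2 r, r \in D & tr r = tr j.
Proof.
pose rep j := odflt j [pick j' | tr j' == tr j].
have trr j : tr (rep j) = tr j.
  by rewrite /rep; case: pickP => [j' /eqP//|/(_ j)]; rewrite eqxx.
have rep_eq j j' : tr j = tr j' -> rep j = rep j'.
  rewrite /rep => ->; case: pickP => // /(_ j'); by rewrite eqxx.
exists [set rep j | j : J]%SET => [|j]; last by exists (rep j); rewrite ?imset_f.
rewrite -(card_in_imset (f := tr)) => [|_ _ /imsetP[j _ ->] /imsetP[j' _ ->]].
  by apply/subset_leq_card/fintype.subsetP => _ /imsetP[_ /imsetP[j _ ->] ->];
    exact: imset_f.
by rewrite !trr => /rep_eq.
Qed.

Lemma grid_close (R : realType) (K : nat) (a b : R) : (0 < K)%N ->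
  -1 <= a <= 1 -> -1 <= b <= 1 ->
  (forall k : 'I_(2 * K), (-1 + k%:R / K%:R < a) = (-1 + k%:R / K%:R < b)) ->
  `|a - b| <= K%:R^-1.
Proof.
move=> K0; wlog ab : a b / a <= b.
  move=> wl a1 b1 e; case: (leP a b) => [ab|/ltW ba]; first exact: wl.
  by rewrite distrC; apply: wl.
move=> /andP[a1 a2] /andP[b1 b2] e; rewrite distrC ger0_norm ?subr_ge0//.
rewrite leNgt; apply/negP => h.
have K0r : (0 : R) < K%:R by rewrite ltr0n.
pose x := (a + 1) * K%:R.
have x0 : 0 <= x by rewrite mulr_ge0 ?ler0n// -lerBlDr sub0r.
have /andP[x1 x2] : (Num.truncn x)%:R <= x < (Num.truncn x).+1%:R by exact: truncn_itv.
(* The first grid point above [a] is within [K%:R^-1] of [a], hence below [b], and it separates the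
   two. Its index is less than [2 * K] because [b <= 1]. *)
have [k ka kb] : exists2 k : nat, a <= -1 + k%:R / K%:R & -1 + k%:R / K%:R < b.
  exists (Num.truncn x).+1.
    rewrite addrC -lerBlDr opprK ler_pdivlMr//; exact: ltW.
  rewrite addrC ltrBlDr -natr1 mulrDl mul1r.
  have : (Num.truncn x)%:R / K%:R <= a + 1 by rewrite ler_pdivrMr.
  lra.
have k2 : (k < 2 * K)%N.
  have := lt_le_trans kb b2; rewrite addrC ltrBlDr ltr_pdivrMr//.
  by rewrite -[X in X * _](natrD _ 1 1) -natrM ltr_nat.
by have := e (Ordinal k2); rewrite /= kb ltNge ka.
Qed.

(** By quasiconcavity, each comparison of [phi (z i) (g j _)] with one of the [2 * K] grid levels is
    decided by two threshold tests on [g j]. Functions with the same trace on these [4 * N * K]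
    points thus agree on all comparisons and are [1 / K]-close; one representative per trace
    suffices. *)
Lemma vc_subgraph_cover (W Z : Type) (R : realType) (F : set (W -> R)) (V : nat)
    (I : set R) (wz : Z -> W) (phi : Z -> R -> R) (J : finType) (g : J -> W -> R)
    (N K : nat) (z : 'I_N -> Z) :
  vc_subgraph F V -> (forall f, F f -> forall w, I (f w)) ->
  (forall z x, I x -> -1 <= phi z x <= 1) ->
  (forall z x1 x2 x3, I x1 -> I x2 -> I x3 -> x1 <= x2 <= x3 ->
    Num.min (phi z x1) (phi z x3) <= phi z x2) ->
  (forall j, F (g j)) -> (0 < K)%N ->
  exists2 D : {set J}, (#|D| <= \sum_(i < V.+1) 'C(4 * N * K, i))%N &
    forall j, exists2 r, r \in D & forall i,
      `|phi (z i) (g j (wz (z i))) - phi (z i) (g r (wz (z i)))| <= K%:R^-1.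
Proof.
move=> vcF FI phi1 phi_qc Fg K0.
have Ig j w : I (g j w) by exact: FI.
pose t (k : 'I_(2 * K)) : R := -1 + k%:R / K%:R.
have /choice[s sP] : forall ik : 'I_N * 'I_(2 * K), exists s : R * R, forall j,
    (t ik.2 < phi (z ik.1) (g j (wz (z ik.1)))) =
    (s.1 < g j (wz (z ik.1))) && ~~ (s.2 < g j (wz (z ik.1))).
  move=> [i k] /=.
  apply: (@bracket _ _ (fun j => g j (wz (z i))) (fun x => t k < phi (z i) x)).
  move=> j1 j2 j3 le123 lt1 lt3.
  apply: lt_le_trans (phi_qc (z i) _ _ _ (Ig _ _) (Ig _ _) (Ig _ _) le123).
  by rewrite lt_min lt1.
pose p (q : 'I_N * 'I_(2 * K) * bool) :=
  (wz (z q.1.1), if q.2 then (s q.1).2 else (s q.1).1).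
pose tr j := [set q | ((p q).2 < g j (p q).1)%R]%SET.
have [D cD trD] := transversal_exists tr; exists D.
  apply: (leq_trans cD).
  apply: leq_trans (vc_subgraph_traces p vcF Fg) _.
  rewrite !card_prod !card_ord card_bool.
  by rewrite (_ : N * (2 * K) * 2 = 4 * N * K)%N// mulnA -mulnA mulnC; ring.
move=> j; have [r rD trr] := trD j; exists r => // i.
apply: grid_close; rewrite ?phi1// => k.
have /setP e := trr; have := e (i, k, true); have := e (i, k, false).
rewrite !inE /p /= => e1 e2.
by rewrite -/(t k) !(sP (i, k)) /= e1 e2.
Qed.

(** * Symmetrization one coordinate at a time *)

Section symmetrization.
Context (R : realType) (J : finType) (T : eqType) (K : J -> T -> T -> R).
Implicit Types (z : T * T) (bs : seq (J -> R)).

(** Each weight [b] branches into two, one for each order of the pair [z], with probability one half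
    each. The list thus enumerates all exchanges of the pairs treated so far, with their
    probabilities included in the weights. *)
Definition symmetrize z bs : seq (J -> R) :=
  [seq (fun j => 2^-1 * b j * K j z.1 z.2) | b <- bs] ++
  [seq (fun j => 2^-1 * b j * K j z.2 z.1) | b <- bs].

Definition symmetrize_all (zs : seq (T * T)) bs :=
  foldl (fun bs z => symmetrize z bs) bs zs.

(** The maximum is taken inside the average over exchanges; its starting value 0 is harmless for the
    nonnegative products considered. *)
Definition summax bs (v : J -> R) : R :=
  \sum_(b <- bs) \big[Num.max/0]_j (b j * v j).

Hypothesis K_ge0 : forall j x y, 0 <= K j x y.

Lemma symmetrize_ge0 z bs : {in bs, forall b j, 0 <= b j} ->
  {in symmetrize z bs, forall b j, 0 <= b j}.
Proof.
move=> bs0 b; rewrite mem_cat => /orP[] /mapP[b' /bs0 b'0 ->] j;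
  by rewrite mulr_ge0// mulr_ge0// invr_ge0.
Qed.

Lemma symmetrize_all_ge0 zs bs : {in bs, forall b j, 0 <= b j} ->
  {in symmetrize_all zs bs, forall b j, 0 <= b j}.
Proof. by elim: zs bs => //= z zs IH bs bs0; apply/IH/symmetrize_ge0. Qed.

Lemma summax_symmetrize z bs v :
  summax (symmetrize z bs) v =
  2^-1 * (summax bs (fun j => v j * K j z.1 z.2) +
          summax bs (fun j => v j * K j z.2 z.1)).
Proof.
have max_half (F : J -> R) :
    2^-1 * \big[Num.max/0]_j F j = \big[Num.max/0]_j (2^-1 * F j).
  rewrite (@big_morph _ _ (fun x => 2^-1 * x) 0 Num.max 0 Num.max) ?mulr0//.
  by move=> x y /=; rewrite maxr_pMr.
rewrite /summax big_cat !big_map /= mulrDr !mulr_sumr.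
by congr (_ + _); apply: eq_bigr => b _; rewrite max_half; apply: eq_bigr => j _;
  ring.
Qed.

Hypothesis K_sym : forall j x y, 2^-1 * (K j x y + K j y x) <= 1.

(** For a fixed [j], the two branches of [b] add up to [b j] times a mean of two kernels, which
    [K_sym] bounds by 1. *)
Lemma sum_symmetrize_all zs bs j : {in bs, forall b j, 0 <= b j} ->
  \sum_(b <- symmetrize_all zs bs) b j <= \sum_(b <- bs) b j.
Proof.
elim: zs bs => [|z zs IH] bs bs0 //=.
apply: le_trans (IH _ _) _; first exact: symmetrize_ge0.
rewrite big_cat !big_map /= -big_split /= !big_seq.
apply: ler_sum => b /bs0 b0.
rewrite (_ : _ + _ = b j * (2^-1 * (K j z.1 z.2 + K j z.2 z.1))); last by ring.
by rewrite ler_piMr.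
Qed.

(** Replacing [j] by [r] costs one factor [th] per pair, whichever order the branch has chosen. *)
Lemma symmetrize_all_close (th : R) (j r : J) zs bs (c : R) : 0 <= th ->
  {in zs, forall z, K j z.1 z.2 <= th * K r z.1 z.2 /\
                    K j z.2 z.1 <= th * K r z.2 z.1} ->
  {in bs, forall b j, 0 <= b j} -> {in bs, forall b, b j <= c * b r} ->
  {in symmetrize_all zs bs, forall b, b j <= c * th ^+ size zs * b r}.
Proof.
move=> th0; elim: zs bs c => [|z zs IH] bs c h bs0 hbs b /=.
  by rewrite expr0 mulr1 => /hbs.
rewrite exprS mulrA => bz; apply: IH bz.
- by move=> z' zzs; apply: h; rewrite in_cons zzs orbT.
- exact: symmetrize_ge0.
have [h1 h2] := h z (mem_head _ _).
move=> b'; rewrite mem_cat => /orP[] /mapP[b0 b0bs ->].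
- apply: le_trans (_ : 2^-1 * (c * b0 r) * (th * K r z.1 z.2) <= _).
    apply: ler_pM => //; first by rewrite mulr_ge0 ?bs0// invr_ge0.
    by rewrite ler_wpM2l ?hbs// invr_ge0.
  by rewrite le_eqVlt; apply/orP; left; apply/eqP; ring.
- apply: le_trans (_ : 2^-1 * (c * b0 r) * (th * K r z.2 z.1) <= _).
    apply: ler_pM => //; first by rewrite mulr_ge0 ?bs0// invr_ge0.
    by rewrite ler_wpM2l ?hbs// invr_ge0.
  by rewrite le_eqVlt; apply/orP; left; apply/eqP; ring.
Qed.

(* The maximum over J is controlled by the sum over a set of representatives
   whose symmetrized expectations are at most 1. *)
Lemma summax_symmetrize_all (th : R) (D : {set J}) zs : 0 <= th ->
  (forall j, exists2 r, r \in D & {in zs, forall z,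
     K j z.1 z.2 <= th * K r z.1 z.2 /\ K j z.2 z.1 <= th * K r z.2 z.1}) ->
  summax (symmetrize_all zs [:: fun=> 1]) (fun=> 1) <= th ^+ size zs * #|D|%:R.
Proof.
move=> th0 hD; set bs := symmetrize_all _ _.
have one0 : {in [:: fun=> 1], forall (b : J -> R) j, 0 <= b j}.
  by move=> b; rewrite inE => /eqP ->.
have bs0 := symmetrize_all_ge0 one0 (zs := zs).
apply: (@le_trans _ _ (\sum_(b <- bs) \sum_(r in D) th ^+ size zs * b r)).
  rewrite /summax !big_seq; apply: ler_sum => b bbs.
  apply: bigmax_le => [|j _].
    by apply: sumr_ge0 => r _; rewrite mulr_ge0 ?exprn_ge0//; exact: bs0.
  have [r rD jr] := hD j.
  rewrite mulr1 (bigD1 r)//=; apply: ler_wpDr.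
    by apply: sumr_ge0 => r' _; rewrite mulr_ge0 ?exprn_ge0//; exact: bs0.
  rewrite -[X in X * _]mul1r.
  apply: (@symmetrize_all_close th j r zs [:: fun=> 1]) bbs => //.
  by move=> b'; rewrite inE => /eqP ->; rewrite mulr1.
rewrite exchange_big /= -sumr_const mulr_sumr; apply: ler_sum => r _.
rewrite -mulr_sumr ler_wpM2l ?exprn_ge0//.
by apply: le_trans (sum_symmetrize_all _ _ one0) _; rewrite big_seq1.
Qed.

End symmetrization.

(** * Independence of a coordinate from the preceding ones *)

Section prefix_law.
Context dO (Omega : measurableType dO) (R : realType) (P : probability Omega R).
Context d (T : measurableType d) (X : nat -> {mfun Omega >-> T}).
Local Open Scope ereal_scope.

Definition sample_prefix k (omega : Omega) : k.-tuple T := [tuple X i omega | i < k].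

Let measurable_sample_prefix k : measurable_fun setT (sample_prefix k).
Proof.
apply/measurable_fun_tnthP => i.
rewrite (_ : _ \o _ = X i)//; apply/funext => omega /=.
by rewrite tnth_mktuple.
Qed.

HB.instance Definition _ k :=
  isMeasurableFun.Build _ _ _ _ (@sample_prefix k) (@measurable_sample_prefix k).

Definition rectangles k : set (set (k.-tuple T)) :=
  [set A | exists2 B : 'I_k -> set T, (forall i, measurable (B i)) &
           A = [set t | forall i, B i (tnth t i)]].

Lemma measurable_rectangles k : measurable = <<s @rectangles k >>.
Proof.
apply/seteqP; split.
- apply: smallest_sub; first exact: smallest_sigma_algebra.
  rewrite -bigcup_seq /=; apply: bigcup_sub => i _ A [B mB].
  rewrite setTI => <-; apply: sub_sigma_algebra.
  exists (fun j => if j == i then B else setT) => [j|]; first by case: ifP.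
  apply/seteqP; split => [t /= Bt j|t /(_ i)]; last by rewrite eqxx.
  by case: eqP => // ->.
- apply: smallest_sub; first exact: sigma_algebra_measurable.
  move=> _ [B mB ->].
  rewrite (_ : [set t | _] = \bigcap_(i in [set: 'I_k]) ((@tnth _ _ ^~ i) @^-1` B i)).
    apply: fin_bigcap_measurable; first exact: finite_finset.
    by move=> i _; rewrite -[X in measurable X]setTI; exact: measurable_tnth.
  by apply/seteqP; split => t Bt i => [_|]; exact: Bt.
Qed.

Lemma rectangles_setI k : setI_closed (@rectangles k).
Proof.
move=> _ _ [B mB ->] [C mC ->]; exists (fun i => B i `&` C i).
  by move=> i; exact: measurableI.
apply/seteqP; split => [t [Bt Ct] i|t BCt]; first by split.
by split => i; have [] := BCt i.
Qed.

(** For a fixed [B], both sides are finite measures in [A]; mutual independence makes them agree on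
    rectangles, a generating pi-system. *)
Lemma sample_prefix_indep n k : (k < n)%N ->
  mutually_independent P (fun i : 'I_n => X i : Omega -> T) ->
  forall A B, measurable A -> measurable B ->
  P (sample_prefix k @^-1` A `&` X k @^-1` B) = P (sample_prefix k @^-1` A) * P (X k @^-1` B).
Proof.
move=> kn indX A B mA mB.
have mXB : measurable (X k @^-1` B) by rewrite -[X in measurable X]setTI; exact: measurable_funP.
pose p := NngNum (fine_ge0 (measure_ge0 P (X k @^-1` B))).
suff : pushforward (mrestr P mXB) (sample_prefix k) A = mscale p (distribution P (sample_prefix k)) A.
  rewrite /mscale /pushforward /mrestr /= => ->.
  by rewrite fineK ?fin_num_measure// muleC.
apply: (measure_unique (@rectangles k) (fun=> setT)) => //.
- exact: measurable_rectangles.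
- exact: rectangles_setI.
- by move=> _; exists (fun=> setT) => //; apply/seteqP; split.
- by rewrite bigcup_const//; exists 0%N.
- move=> _ [C mC ->].
  rewrite /= /mscale /distribution /pushforward /mrestr /= fineK ?fin_num_measure//.
  pose kk := Ordinal kn.
  (* The sets are extended to all [n] indices; the filler [setT] is never met, as only indices up to
     [k] enter the intersections below. *)
  pose D (i : 'I_n) := if i == kk then B else
    if insub (i : nat) is Some j then C (j : 'I_k) else setT.
  have mD i : measurable (D i) by rewrite /D; case: ifP => // _; case: insubP.
  have DE (j : 'I_k) : D (widen_ord (ltnW kn) j) = C j.
    rewrite /D; case: eqP => [/(congr1 val) /= jk|_].
      by have := ltn_ord j; rewrite jk ltnn.
    by case: insubP => [j' _ /val_inj ->//|]; rewrite /= ltn_ord.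
  have preE : sample_prefix k @^-1` [set t | forall i, C i (tnth t i)] =
      \bigcap_(i in [set` [set i : 'I_n | (i < k)%N]%SET]) (X i @^-1` D i).
    apply/seteqP; split => omega /= h.
      move=> i; rewrite /= inE => ik.
      have := h (Ordinal ik); rewrite tnth_mktuple -DE.
      by rewrite (_ : widen_ord _ _ = i)//; exact/val_inj.
    move=> j; rewrite tnth_mktuple -DE.
    by apply: (h (widen_ord (ltnW kn) j)); rewrite /= inE /= ltn_ord.
  have preE' : sample_prefix k @^-1` [set t | forall i, C i (tnth t i)] `&` X k @^-1` B =
      \bigcap_(i in [set` [set i : 'I_n | (i <= k)%N]%SET]) (X i @^-1` D i).
    rewrite preE; apply/seteqP; split => omega /= => [[h hk] i|h].
      rewrite /= inE leq_eqVlt => /orP[/eqP ik|ik]; last by apply: h; rewrite /= inE.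
      by rewrite /D (_ : i = kk) ?eqxx//; exact/val_inj.
    split => [i|]; first by rewrite /= inE => ik; apply: h; rewrite /= inE ltnW.
    by have := h kk; rewrite /= inE leqnn /D eqxx; exact.
  rewrite preE' [distribution _ _ _]/(P _) preE !indX// (bigD1 kk) ?inE//=.
  rewrite {1}/D eqxx; congr (_ * _).
  by rewrite -[RHS]/(P _) indX//; apply: eq_bigl => i; rewrite !inE ltn_neqAle andbC -val_eqE.
- move=> _; rewrite /pushforward /mrestr /=.
  by rewrite (le_lt_trans (probability_le1 _ _)) ?ltry// preimage_setT setTI.
Qed.

End prefix_law.

Section prefix_fubini.
Context dO (Omega : measurableType dO) (R : realType) (P : probability Omega R).
Context d (T : measurableType d) (X : nat -> {mfun Omega >-> T}).
Local Open Scope ereal_scope.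

Lemma integral_sample_prefix n k (h : k.-tuple T * T -> \bar R) : (k < n)%N ->
  mutually_independent P (fun i : 'I_n => X i : Omega -> T) ->
  measurable_fun setT h -> (forall z, 0 <= h z) ->
  \int[P]_omega h (sample_prefix X k omega, X k omega) =
  \int[distribution P (sample_prefix X k)]_t \int[distribution P (X k)]_x h (t, x).
Proof.
move=> kn indX mh h0.
pose Z omega := (sample_prefix X k omega, X k omega).
have mZ : measurable_fun setT Z by exact: measurable_fun_pair.
transitivity (\int[pushforward P Z]_z h z).
  by rewrite ge0_integral_pushforward//.
transitivity (\int[distribution P (sample_prefix X k) \x distribution P (X k)]_z h z).
  apply: eq_measure_integral => //= A mA _.
  apply/esym; apply: product_measure_unique => // B C mB mC.
  rewrite /distribution /pushforward -(sample_prefix_indep kn indX mB mC).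
  by congr (P _).
by rewrite fubini_tonelli1.
Qed.

End prefix_fubini.

Lemma measurable_bigmaxr d (T : measurableType d) (R : realType) (I : Type)
    (s : seq I) (F : I -> T -> R) : (forall i, measurable_fun setT (F i)) ->
  measurable_fun setT (fun x => \big[Num.max/0]_(i <- s) F i x).
Proof.
move=> mF; elim: s => [|i s IH].
  by under eq_fun do rewrite big_nil; exact: measurable_cst.
by under eq_fun do rewrite big_cons; exact: measurable_maxr.
Qed.

Lemma measurable_summax d (T : measurableType d) (R : realType) (J : finType)
    (bs : seq (J -> R)) (F : J -> T -> R) : (forall j, measurable_fun setT (F j)) ->
  measurable_fun setT (fun x => summax bs (fun j => F j x)).
Proof.
move=> mF; apply: measurable_sum => b; apply: measurable_bigmaxr => j.
exact: measurable_funM.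
Qed.

Lemma summax_ge0 (R : realType) (J : finType) (bs : seq (J -> R)) (v : J -> R) :
  0 <= summax bs v.
Proof. by apply: sumr_ge0 => b _; exact: bigmax_ge_id. Qed.

(** As [x] and [y] have the same law [p], [H] can be replaced by its mean over their exchange.
    Tonelli then moves the integral in [t] innermost, where the hypothesis holds for each frozen
    pair. *)
Lemma symmetrized_integral_le d d' (U : measurableType d) (T : measurableType d')
    (R : realType) (Q : {sigma_finite_measure set U -> \bar R})
    (p : {sigma_finite_measure set T -> \bar R}) (H : U * (T * T) -> \bar R) (C : R) :
  p setT = 1%E -> measurable_fun setT H -> (forall z, 0 <= H z)%E ->
  (forall x y, \int[Q]_t (2^-1%:E * (H (t, (x, y)) + H (t, (y, x)))) <= C%:E)%E ->
  (\int[Q]_t \int[p]_x \int[p]_y H (t, (x, y)) <= C%:E)%E.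
Proof.
move=> p1 mH H0 hC.
pose S (t : U) (z : T * T) := (2^-1%:E * (H (t, z) + H (t, (z.2, z.1))))%E.
have mHs : measurable_fun setT (fun tz : U * (T * T) => H (tz.1, (tz.2.2, tz.2.1))).
  apply: (measurableT_comp mH); apply: measurable_fun_pair => //.
  by apply: measurable_fun_pair; exact: measurableT_comp.
have mS : measurable_fun setT (fun tz => S tz.1 tz.2).
  apply: emeasurable_funM => //; apply: emeasurable_funD => //.
  by apply: (measurableT_comp mH); apply: measurable_fun_pair.
have S0 t z : (0 <= S t z)%E by rewrite mule_ge0 ?adde_ge0// lee_fin invr_ge0.
have HS t : (\int[p]_x \int[p]_y H (t, (x, y)) = \int[p]_x \int[p]_y S t (x, y))%E.
  have mHt : measurable_fun setT (fun z => H (t, z)) by exact: measurable_fun_pair2.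
  have mH1 x : measurable_fun setT (fun y => H (t, (x, y))).
    by apply: (measurable_fun_pair2 (f := fun z => H (t, z))).
  have mH2 x : measurable_fun setT (fun y => H (t, (y, x))).
    by apply: (measurable_fun_pair1 (f := fun z => H (t, z))).
  transitivity (\int[p]_x (2^-1%:E *
      (\int[p]_y H (t, (x, y)) + \int[p]_y H (t, (y, x)))))%E; last first.
    apply: eq_integral => x _; rewrite /S /= ge0_integralZl_EFin//; last 2 first.
    - by move=> z _; rewrite adde_ge0.
    - exact: emeasurable_funD.
    by rewrite ge0_integralD.
  have mF := measurable_fun_fubini_tonelli_F (m2 := p) _ mHt (fun=> H0 _).
  have mG := measurable_fun_fubini_tonelli_G (m1 := p) _ mHt (fun=> H0 _).
  rewrite ge0_integralZl_EFin//; last 2 first.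
  - by move=> x _; rewrite adde_ge0//; exact: integral_ge0.
  - exact: emeasurable_funD.
  have i1 x : [set: T] x -> (0 <= \int[p]_y H (t, (x, y)))%E.
    by move=> _; exact: integral_ge0.
  have i2 x : [set: T] x -> (0 <= \int[p]_y H (t, (y, x)))%E.
    by move=> _; exact: integral_ge0.
  have iD := ge0_integralD p measurableT i1 mF i2 mG.
  rewrite [X in (_ * X)%E]iD.
  rewrite -(fubini_tonelli (fun z => H (t, z)))//.
  by rewrite -mule2n -[(_ *+ 2)%E]mule_natl muleA -EFinM mulVf// mul1e.
under eq_integral do rewrite HS.
have mS1 : measurable_fun setT (fun z : (U * T) * T => S z.1.1 (z.1.2, z.2)).
  apply: (measurableT_comp mS (g := fun z : (U * T) * T => (z.1.1, (z.1.2, z.2)))).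
  apply: measurable_fun_pair; first exact: measurableT_comp.
  by apply: measurable_fun_pair => //; exact: measurableT_comp.
have mS2 := measurable_fun_fubini_tonelli_F (m2 := p) _ mS1 (fun=> S0 _ _).
(* The integral over [t] is exchanged first with the one over [x], and further on with the one over
   [y]. *)
rewrite (fubini_tonelli (fun z : U * T => \int[p]_y S z.1 (z.2, y))%E)//; last first.
  by move=> z; exact: integral_ge0.
have iS (z : U * T) : (0 <= \int[p]_y S z.1 (z.2, y))%E by exact: integral_ge0.
have mSG := measurable_fun_fubini_tonelli_G (m1 := Q) _ mS2 iS.
have intC : (\int[p]_x C%:E = C%:E)%E by rewrite integral_cst// [X in (_ * X)%E]p1 mule1.
rewrite -[leRHS]intC; apply: ge0_le_integral => //.
  by move=> x _; apply: integral_ge0 => t _; exact: integral_ge0.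
move=> x _.
have mS3 : measurable_fun setT (fun z : U * T => S z.1 (x, z.2)).
  apply: (measurableT_comp mS (g := fun z : U * T => (z.1, (x, z.2)))).
  by apply: measurable_fun_pair => //; exact: measurable_fun_pair.
rewrite (fubini_tonelli (fun z : U * T => S z.1 (x, z.2)))//.
have mSG3 := measurable_fun_fubini_tonelli_G (m1 := Q) _ mS3 (fun=> S0 _ _).
rewrite -[leRHS]intC; apply: ge0_le_integral => //.
  by move=> y _; exact: integral_ge0.
by move=> y _; exact: hC.
Qed.

Section decoupling.
Context dO (Omega : measurableType dO) (R : realType) (P : probability Omega R).
Context d (T : measurableType d) (X : nat -> {mfun Omega >-> T}) (n : nat).
Hypothesis indX : mutually_independent P (fun i : 'I_n => X i : Omega -> T).
Context (J : finType) (e : nat -> J -> T -> R) (K : J -> T -> T -> R).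
Hypothesis e_ge0 : forall i j x, 0 <= e i j x.
Hypothesis me : forall i j, measurable_fun setT (e i j).
Hypothesis K_ge0 : forall j x y, 0 <= K j x y.
Hypothesis mK : forall j, measurable_fun setT (fun z : T * T => K j z.1 z.2).
Hypothesis eK : forall i j x, (i < n)%N ->
  ((e i j x)%:E <= \int[distribution P (X i)]_y (K j x y)%:E)%E.

(** A maximum of integrals is at most the integral of the maximum: this introduces the ghost
    observation [y]. *)
Lemma summax_le_integral i bs v x : (i < n)%N ->
  {in bs, forall b j, 0 <= b j} -> (forall j, 0 <= v j) ->
  ((summax bs (fun j => v j * e i j x))%:E <=
   \int[distribution P (X i)]_y (summax bs (fun j => v j * K j x y))%:E)%E.
Proof.
move=> lin bs0 v0.
have mKx j : measurable_fun setT (K j x).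
  exact: (measurable_fun_pair2 (f := fun z => K j z.1 z.2)).
have mb (b : J -> R) j : measurable_fun setT (fun y => b j * (v j * K j x y)).
  by apply: measurable_funM => //; exact: measurable_funM.
have mmax (b : J -> R) : measurable_fun setT
    (fun y => (\big[Num.max/0]_j (b j * (v j * K j x y)))%:E).
  by apply/measurable_EFinP; apply: measurable_bigmaxr.
under eq_integral do rewrite /summax -sumEFin.
rewrite ge0_integral_sum//; last by move=> b y _; rewrite lee_fin bigmax_ge_id.
rewrite -sumEFin !big_seq; apply: lee_sum => b bbs.
have int0 : (0 <= \int[distribution P (X i)]_y
    (\big[Num.max/0]_j (b j * (v j * K j x y)))%:E)%E.
  by apply: integral_ge0 => y _; rewrite lee_fin bigmax_ge_id.
rewrite (@big_morph _ _ EFin 0%E Order.max 0 Num.max)//; last exact: EFin_max.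
apply: bigmax_le => // j _.
rewrite mulrA EFinM; apply: (@le_trans _ _ ((b j * v j)%:E *
    \int[distribution P (X i)]_y (K j x y)%:E)%E).
  apply: lee_wpmul2l; last exact: eK.
  by rewrite lee_fin mulr_ge0//; exact: bs0.
rewrite -ge0_integralZl_EFin//; last 3 first.
- by move=> y _; rewrite lee_fin.
- exact/measurable_EFinP.
- by rewrite mulr_ge0//; exact: bs0.
apply: ge0_le_integral => //.
- by move=> y _; rewrite -EFinM lee_fin !mulr_ge0//; exact: bs0.
- by apply/measurable_EFinP; apply: measurable_funM.
- by move=> y _; rewrite -EFinM lee_fin -mulrA; exact: le_bigmax.
Qed.

(** Induction on the number of random coordinates. The last one is paired with a ghost copy and the
    pair is frozen, which turns the weights [bs] into [symmetrize K (x, y) bs], still deterministic.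
    This is why [bs] is arbitrary; in the end only a bound over fixed sequences of pairs remains. *)
Lemma decoupling k bs (C : R) : (k <= n)%N -> {in bs, forall b j, 0 <= b j} ->
  (forall zs, size zs = k -> summax (symmetrize_all K zs bs) (fun=> 1) <= C) ->
  (\int[P]_omega
    (summax bs (fun j => \prod_(i < k) e i j (X i omega)))%:E <= C%:E)%E.
Proof.
elim: k bs C => [|k IH] bs C kn bs0 hC.
  under eq_integral.
    move=> omega _; rewrite (_ : (fun j => _) = (fun=> 1)); last first.
      by apply/funext => j; rewrite big_ord0.
    over.
  by rewrite integral_cst//= probability_setT mule1 lee_fin (hC [::]).
pose G j (t : k.-tuple T) := \prod_(i < k) e i j (tnth t i).
have G0 j t : 0 <= G j t by exact: prodr_ge0.
have mG j : measurable_fun setT (G j).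
  apply: measurable_prod => i _; apply: measurableT_comp => //.
  exact: measurable_tnth.
have GE j omega : G j (sample_prefix X k omega) = \prod_(i < k) e i j (X i omega).
  by apply: eq_bigr => i _; rewrite tnth_mktuple.
pose h (z : k.-tuple T * T) := (summax bs (fun j => G j z.1 * e k j z.2))%:E.
have mh : measurable_fun setT h.
  apply/measurable_EFinP; apply: measurable_summax => j.
  by apply: measurable_funM; exact: measurableT_comp.
under eq_integral.
  move=> omega _; rewrite (_ : _%:E = h (sample_prefix X k omega, X k omega)); last first.
    rewrite /h /=; congr (summax _ _)%:E; apply/funext => j.
    by rewrite big_ord_recr /= GE.
  over.
rewrite (integral_sample_prefix kn indX)//; last by move=> z; rewrite lee_fin summax_ge0.
pose H (tz : k.-tuple T * (T * T)) :=
  (summax bs (fun j => G j tz.1 * K j tz.2.1 tz.2.2))%:E.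
have mH : measurable_fun setT H.
  apply/measurable_EFinP; apply: measurable_summax => j; apply: measurable_funM.
    exact: measurableT_comp.
  exact: (measurableT_comp (mK j)).
have H0 z : (0 <= H z)%E by rewrite lee_fin summax_ge0.
(* The factor [e k] is replaced by the integral of [K] over the ghost copy. *)
apply: (@le_trans _ _ (\int[distribution P (sample_prefix X k)]_t
    \int[distribution P (X k)]_x \int[distribution P (X k)]_y H (t, (x, y)))%E).
  have mHtx : measurable_fun setT (fun z : (k.-tuple T * T) * T =>
      H (z.1.1, (z.1.2, z.2))).
    apply: (measurableT_comp mH); apply: measurable_fun_pair.
      exact: measurableT_comp.
    by apply: measurable_fun_pair => //; exact: measurableT_comp.
  have mHI : measurable_fun setT (fun z : k.-tuple T * T =>
      \int[distribution P (X k)]_y H (z.1, (z.2, y)))%E.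
    exact: (measurable_fun_fubini_tonelli_F
      (fun z : (k.-tuple T * T) * T => H (z.1.1, (z.1.2, z.2)))).
  apply: ge0_le_integral => //.
  - by move=> t _; apply: integral_ge0 => x _; rewrite lee_fin summax_ge0.
  - by apply: measurable_fun_fubini_tonelli_F => // z; rewrite lee_fin summax_ge0.
  - apply: (measurable_fun_fubini_tonelli_F (fun z : k.-tuple T * T =>
      \int[distribution P (X k)]_y H (z.1, (z.2, y)))%E) => // z.
    exact: integral_ge0.
  move=> t _; apply: ge0_le_integral => //.
  - by move=> x _; rewrite lee_fin summax_ge0.
  - exact: measurable_fun_pair2.
  - exact: (measurable_fun_pair2 (f := fun z : k.-tuple T * T =>
      \int[distribution P (X k)]_y H (z.1, (z.2, y)))%E).
  - by move=> x _; exact: summax_le_integral.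
apply: symmetrized_integral_le => // [|x y]; first exact: probability_setT.
have HE t : (2^-1%:E * (H (t, (x, y)) + H (t, (y, x))) =
    (summax (symmetrize K (x, y) bs) (fun j => G j t))%:E)%E.
  by rewrite /H summax_symmetrize EFinM EFinD.
under eq_integral do rewrite HE.
rewrite ge0_integral_distribution//; last 2 first.
- apply/measurable_EFinP; exact: measurable_summax.
- by move=> t; rewrite lee_fin summax_ge0.
under eq_integral.
  move=> omega _; rewrite /= (_ : (fun j => _) =
    (fun j => \prod_(i < k) e i j (X i omega))); last by apply/funext => j; exact: GE.
  over.
apply: IH; [exact: ltnW|exact: symmetrize_ge0|].
by move=> zs zsk; apply: (hC ((x, y) :: zs)); rewrite /= zsk.
Qed.

End decoupling.

(** * Deviations over a class of functions *)

(** From [1 - y <= expR (- y)], the product [expR y * (1 - y)] is at most 1, while the quadratic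
    times [1 - y] equals [1 + y ^+ 2 * (1 - 2 * y) >= 1]. *)
Lemma expR_le_quad (R : realType) (y : R) : `|y| <= 2^-1 ->
  expR y <= 1 + y + 2 * y ^+ 2.
Proof.
rewrite ler_norml => /andP[_ y2].
have h : expR y * (1 - y) <= 1.
  rewrite -[leRHS](mulfV (lt0r_neq0 (expR_gt0 y))) ler_pM2l ?expR_gt0//.
  by rewrite -expRN expR_ge1Dx.
have y1 : 0 < 1 - y by lra.
rewrite -(ler_pM2r y1) (le_trans h)//.
have -> : (1 + y + 2 * y ^+ 2) * (1 - y) = 1 + y ^+ 2 * (1 - 2 * y) by ring.
rewrite lerDl mulr_ge0 ?sqr_ge0//; lra.
Qed.

(* The correction b^2 / 10 pays for the second-order terms in sym_kernel_le1. *)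
Definition sym_kernel (R : realType) (a b : R) : R :=
  expR ((a - (b + b ^+ 2 / 10)) / 100).

Lemma measurable_sym_kernel d (T : measurableType d) (R : realType) (f g : T -> R) :
  measurable_fun setT f -> measurable_fun setT g ->
  measurable_fun setT (fun x => sym_kernel (f x) (g x)).
Proof.
move=> mf mg; apply: (@measurableT_comp _ _ _ _ _ _ (@expR R)) => //.
apply: measurable_funM => //; apply: measurable_funB => //.
apply: measurable_funD => //; apply: measurable_funM => //.
exact: measurable_funX.
Qed.

(** The linear terms cancel in the sum. The correction contributes [- (a ^+ 2 + b ^+ 2) / 1000], and
    the second-order terms at most [442 / 500000] times [a ^+ 2 + b ^+ 2]. *)
Lemma sym_kernel_le1 (R : realType) (a b : R) : `|a| <= 1 -> `|b| <= 1 ->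
  2^-1 * (sym_kernel a b + sym_kernel b a) <= 1.
Proof.
rewrite !ler_norml => /andP[a1 a2] /andP[b1 b2].
have sqr1 (c : R) : -1 <= c -> c <= 1 -> c ^+ 2 <= 1 by move=> *; nra.
have a21 := sqr1 a a1 a2; have b21 := sqr1 b b1 b2.
have a20 := sqr_ge0 a; have b20 := sqr_ge0 b.
(* The square of the exponent is bounded by twice the sum of squares; [242 / 100] is
   [2 * (11 / 10) ^+ 2], as [1 + d / 10] is at most [11 / 10]. *)
have quad (c d : R) : -1 <= c -> c <= 1 -> -1 <= d -> d <= 1 -> c ^+ 2 <= 1 ->
    d ^+ 2 <= 1 -> 0 <= d ^+ 2 ->
    sym_kernel c d <= 1 + (c - (d + d ^+ 2 / 10)) / 100 +
      (2 * c ^+ 2 + 242 / 100 * d ^+ 2) / 5000.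
  move=> c1 c2 d1 d2 c21 d21 d20.
  apply: le_trans (expR_le_quad _) _; first by rewrite ler_norml; lra.
  rewrite lerD2l.
  have -> : 2 * ((c - (d + d ^+ 2 / 10)) / 100) ^+ 2 =
     (c - (d + d ^+ 2 / 10)) ^+ 2 / 5000 by field.
  rewrite ler_pM2r; last by rewrite invr_gt0; lra.
  have -> : d + d ^+ 2 / 10 = d * (1 + d / 10) by ring.
  apply: (@le_trans _ _ (2 * c ^+ 2 + 2 * (d * (1 + d / 10)) ^+ 2)).
    rewrite -subr_ge0 (_ : _ - _ = (c + d * (1 + d / 10)) ^+ 2) ?sqr_ge0//; ring.
  rewrite lerD2l exprMn.
  have : (1 + d / 10) ^+ 2 <= 121 / 100 by nra.
  by move=> h; have := ler_wpM2l d20 h; lra.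
have := quad a b a1 a2 b1 b2 a21 b21 b20.
have := quad b a b1 b2 a1 a2 b21 a21 a20.
lra.
Qed.

(** The terms in [a], [b] and [b ^+ 2 / 10] move by at most [dl], [dl] and [dl / 5], so [3 * dl]
    covers their sum. *)
Lemma sym_kernel_close (R : realType) (a b a' b' dl : R) :
  `|a| <= 1 -> `|b| <= 1 -> `|a'| <= 1 -> `|b'| <= 1 ->
  `|a - a'| <= dl -> `|b - b'| <= dl ->
  sym_kernel a b <= expR (3 * dl / 100) * sym_kernel a' b'.
Proof.
rewrite /sym_kernel -expRD ler_expR !ler_norml.
move=> /andP[a1 a2] /andP[b1 b2] /andP[a1' a2'] /andP[b1' b2'] /andP[d1 d2] /andP[d1' d2'].
have : b' ^+ 2 - b ^+ 2 <= 2 * dl.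
  have -> : b' ^+ 2 - b ^+ 2 = - (b - b') * (b' + b) by ring.
  nra.
lra.
Qed.

Lemma bounded_integrable d (T : measurableType d) (R : realType)
    (P : {finite_measure set T -> \bar R}) (f : T -> R) (c : R) :
  measurable_fun setT f -> (forall x, `|f x| <= c) ->
  P.-integrable setT (EFin \o f).
Proof.
move=> mf fc; apply/integrableP; split; first exact/measurable_EFinP.
apply: (@le_lt_trans _ _ (\int[P]_x c%:E)%E).
  apply: ge0_le_integral => //.
  - by apply/measurable_EFinP; exact: measurableT_comp.
  - by move=> x _; rewrite lee_fin.
rewrite integral_cst// lte_mul_pinfty ?lee_fin// ?ltey_eq ?fin_num_measure//.
exact: le_trans (fc point).
Qed.

Lemma normr_Rintegral_le d (T : measurableType d) (R : realType)
    (p : probability T R) (f : T -> R) (c : R) :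
  measurable_fun setT f -> (forall x, `|f x| <= c) -> `|\int[p]_x f x| <= c.
Proof.
move=> mf fc; rewrite (le_trans (le_normr_Rintegral _ _))//.
  exact: bounded_integrable mf fc.
have -> : c = \int[p]_(x in setT) c.
  rewrite Rintegral_cst// [X in _ = _ * X](_ : _ = 1) ?mulr1//.
  by rewrite -[RHS]/(fine 1%E) -(@probability_setT _ _ _ p).
apply: le_Rintegral => //.
- apply: (@bounded_integrable _ _ _ _ (fun x => `|f x|) c).
    exact: measurableT_comp.
  by move=> x; rewrite normr_id.
- by apply: (@bounded_integrable _ _ _ _ (cst c) `|c|).
Qed.

Section concentration.
Context dO (Omega : measurableType dO) (R : realType) (P : probability Omega R).
Context d (T : measurableType d) (X : nat -> {mfun Omega >-> T}) (n : nat).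
Hypothesis indX : mutually_independent P (fun i : 'I_n => X i : Omega -> T).

Definition drift (f : T -> R) i : R :=
  \int[distribution P (X i)]_x (f x + f x ^+ 2 / 10).

Definition deviation (f : T -> R) omega : R :=
  \sum_(i < n) (f (X i omega) - drift f i).

Lemma measurable_deviation (f : T -> R) : measurable_fun setT f ->
  measurable_fun setT (deviation f).
Proof.
move=> mf; apply: measurable_sum => i; apply: measurable_funB => //.
exact: measurableT_comp.
Qed.

Lemma measurable_deviation_gt (f : T -> R) (z : R) : measurable_fun setT f ->
  measurable [set omega | z < deviation f omega].
Proof.
move=> mf; rewrite -[X in measurable X]setTI.
have := measurable_deviation mf measurableT (measurable_itv `]z, +oo[).
by congr (measurable (_ `&` _)); apply/seteqP; split => y /=; rewrite in_itv/= andbT.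
Qed.

(** Jensen's inequality, from the tangent bound [1 + t <= expR t] at [t = (drift f i - F y) / 100],
    whose mean is 0. *)
Lemma expR_drift_le (f : T -> R) i x : measurable_fun setT f -> (forall y, `|f y| <= 1) ->
  ((expR ((f x - drift f i) / 100))%:E <=
   \int[distribution P (X i)]_y (sym_kernel (f x) (f y))%:E)%E.
Proof.
move=> mf f1; set p := distribution P (X i); set A := expR _.
pose F y := f y + f y ^+ 2 / 10.
have mF : measurable_fun setT F.
  by apply: measurable_funD => //; apply: measurable_funM => //; exact: measurable_funX.
have F2 y : `|F y| <= 2.
  by have := f1 y; rewrite /F !ler_norml => /andP[? ?]; nra.
have iF : p.-integrable setT (EFin \o F) by exact: bounded_integrable mF F2.
have i1 (c : R) : p.-integrable setT (EFin \o cst c).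
  by apply: (@bounded_integrable _ _ _ _ _ (`|c|)) => //.
have d2 : `|drift f i| <= 2 by exact: normr_Rintegral_le.
have iL : p.-integrable setT (fun y => (A * (1 + (drift f i - F y) / 100))%:E).
  apply: (@bounded_integrable _ _ _ _ _ (A * 2)).
    apply: measurable_funM => //; apply: measurable_funD => //.
    by apply: measurable_funM => //; exact: measurable_funB.
  move=> y; rewrite normrM (ger0_norm (expR_ge0 _)) ler_pM2l ?expR_gt0//.
  move: (F2 y) d2; rewrite !ler_norml => /andP[? ?] /andP[? ?]; lra.
have iS : p.-integrable setT (fun y => (sym_kernel (f x) (f y))%:E).
  apply: (@bounded_integrable _ _ _ _ _ (expR 1)).
    exact: measurable_sym_kernel.
  move=> y; rewrite ger0_norm ?expR_ge0// ler_expR.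
  move: (F2 y) (f1 x); rewrite /F !ler_norml => /andP[? ?] /andP[? ?]; lra.
rewrite -[leRHS]fineK ?lee_fin; last exact: integrable_fin_num.
have AE : \int[p]_y (A * (1 + (drift f i - F y) / 100)) = A.
  have -> : (fun y => A * (1 + (drift f i - F y) / 100)) =
      (fun y => A * (1 + drift f i / 100) - A / 100 * F y).
    by apply/funext => y; field.
  have iAF : p.-integrable setT (fun y => (A / 100 * F y)%:E).
    by under eq_fun do rewrite EFinM; exact: integrableZl.
  rewrite RintegralB//; last exact: (i1 (A * (1 + drift f i / 100))).
  rewrite [X in _ - X](RintegralZl _ measurableT iF) [X in X - _]Rintegral_cst//.
  rewrite [X in _ * X - _](_ : _ = 1); last first.
    by rewrite -[RHS]/(fine 1%E) -(@probability_setT _ _ _ p).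
  by rewrite [X in _ - _ * X](_ : _ = drift f i)//; field.
rewrite -[leLHS]AE; apply: le_Rintegral => // y _.
have -> : sym_kernel (f x) (f y) =
    expR ((f x - drift f i) / 100 + (drift f i - F y) / 100).
  by congr expR; rewrite /F; field.
by rewrite expRD ler_pM2l ?expR_gt0// expR_ge1Dx.
Qed.

(** Markov's inequality for [S], the maximum over [j] of the exponential of a hundredth of the
    deviation: [S] is at least [expR (L + x)] on [E], and its mean is at most [expR L] by
    decoupling. *)
Lemma deviation_finite (J : finType) (f : J -> T -> R) (L x : R) :
  (forall j, measurable_fun setT (f j)) -> (forall j y, `|f j y| <= 1) ->
  (forall zs : seq (T * T), size zs = n ->
    summax (symmetrize_all (fun j y z => sym_kernel (f j y) (f j z)) zs [:: fun=> 1])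
      (fun=> 1) <= expR L) ->
  (P [set omega | exists j, (100 * (L + x) < deviation (f j) omega)%R]
     <= (expR (- x))%:E)%E.
Proof.
move=> mf f1 hL; set E := [set _ | _].
have mE : measurable E.
  have -> : E = \bigcup_(j in [set: J]) [set omega | 100 * (L + x) < deviation (f j) omega].
    by apply/seteqP; split => [omega [j]|omega [j _]]; exists j.
  apply: fin_bigcup_measurable => [|j _]; first exact: finite_finset.
  exact: measurable_deviation_gt.
pose e i j y := expR ((f j y - drift (f j) i) / 100).
pose S omega := summax [:: fun=> 1] (fun j => \prod_(i < n) e i j (X i omega)).
have me i j : measurable_fun setT (e i j).
  apply: (@measurableT_comp _ _ _ _ _ _ (@expR R)) => //.
  by apply: measurable_funM => //; exact: measurable_funB.
have SL : (\int[P]_omega (S omega)%:E <= (expR L)%:E)%E.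
  apply: (@decoupling _ _ _ _ _ _ X n indX J e
    (fun j y z => sym_kernel (f j y) (f j z))) => //.
  - by move=> *; exact: expR_ge0.
  - by move=> *; exact: expR_ge0.
  - by move=> j; apply: measurable_sym_kernel; exact: measurableT_comp.
  - by move=> i j y _; exact: expR_drift_le.
  - by move=> b; rewrite inE => /eqP ->.
have mS : measurable_fun setT S.
  apply: measurable_summax => j; apply: measurable_prod => i _.
  exact: measurableT_comp.
have -> : expR (- x) = (expR (L + x))^-1 * expR L.
  by rewrite -expRN -expRD; congr expR; ring.
rewrite EFinM lee_pdivlMl ?expR_gt0//.
apply: le_trans SL.
apply: (@le_trans _ _ (\int[P]_omega ((expR (L + x))%:E * (\1_E omega)%:E))%E).
  rewrite ge0_integralZl_EFin ?expR_ge0//; last by apply/measurable_EFinP.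
  by rewrite integral_indic// setIT.
apply: ge0_le_integral => //.
- by apply: emeasurable_funM => //; apply/measurable_EFinP.
- by apply/measurable_EFinP.
move=> omega _; rewrite -EFinM lee_fin indicE.
have [|_] := boolP (omega \in E); last by rewrite mulr0 summax_ge0.
rewrite inE => -[j devj]; rewrite mulr1 /S /summax big_seq1.
apply: le_trans (le_bigmax _ _ j); rewrite mul1r /e -expR_sum ler_expR -mulr_suml.
by rewrite ler_pdivlMr ?ltr0n// mulrC ltW.
Qed.

(** The events for the first [N] functions increase to the whole event, and the bound for finite
    families does not depend on [N]. *)
Lemma deviation_seq (f : nat -> T -> R) (L x : R) :
  (forall j, measurable_fun setT (f j)) -> (forall j y, `|f j y| <= 1) ->
  (forall N (zs : seq (T * T)), size zs = n ->
    summax (symmetrize_all (fun (j : 'I_N) y z => sym_kernel (f j y) (f j z)) zs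
      [:: fun=> 1]) (fun=> 1) <= expR L) ->
  (P [set omega | exists j, (100 * (L + x) < deviation (f j) omega)%R]
     <= (expR (- x))%:E)%E.
Proof.
move=> mf f1 hL.
pose E N := [set omega | exists j : 'I_N, 100 * (L + x) < deviation (f j) omega].
have mE N : measurable (E N).
  have -> : E N = \bigcup_(j in [set: 'I_N]) [set omega | 100 * (L + x) < deviation (f j) omega].
    by apply/seteqP; split => [omega [j]|omega [j _]]; exists j.
  by apply: fin_bigcup_measurable => [|j _]; [exact: finite_finset|exact: measurable_deviation_gt].
have -> : [set omega | exists j, (100 * (L + x) < deviation (f j) omega)%R] =
    \bigcup_N E N.
  apply/seteqP; split => [omega [j hj]|omega [N _ [j hj]]]; last by exists j.
  by exists j.+1 => //; exists ord_max.
have cvE : P (E N) @[N --> \oo] --> P (\bigcup_N E N).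
  apply: nondecreasing_cvg_mu => //; first exact: bigcupT_measurable.
  move=> N M NM; apply/subsetPset => omega [j hj].
  by exists (widen_ord NM j).
rewrite -(cvg_lim _ cvE)//; apply: lime_le; first by apply/cvg_ex; eexists; exact: cvE.
by near=> N; apply: deviation_finite => // zs zsn; exact: hL.
Unshelve. all: by end_near. Qed.

End concentration.

Lemma le_ln_addr1 (R : realType) (a : R) : 0 <= a -> ln (a + 1) <= logp a + 1.
Proof.
move=> a0; have ln2 : ln (2 : R) <= 1.
  by have := @le_ln1Dx R 1; rewrite -natr1; apply; lra.
have [a1|a1] := leP a 1.
  apply: (@le_trans _ _ (ln 2)); first by rewrite ler_ln ?posrE//; lra.
  by rewrite (le_trans ln2)// lerDr le_max lexx.
apply: (@le_trans _ _ (ln (a * 2))); first by rewrite ler_ln ?posrE//; lra.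
by rewrite lnM ?posrE//; [rewrite lerD// le_max lexx orbT|lra].
Qed.

Section vc_kernel.
Context (R : realType) (W : Type) (Z : pointedType) (F : set (W -> R)) (V n : nat).
Context (I : set R) (wz : Z -> W) (phi : Z -> R -> R).
Hypothesis vcF : vc_subgraph F V.
Hypothesis V1 : (1 <= V)%N.
Hypothesis FI : forall f, F f -> forall w, I (f w).
Hypothesis phi1 : forall z x, I x -> -1 <= phi z x <= 1.
Hypothesis phi_qc : forall z x1 x2 x3, I x1 -> I x2 -> I x3 -> x1 <= x2 <= x3 ->
  Num.min (phi z x1) (phi z x3) <= phi z x2.

(** The inverse mesh of the cover. It satisfies [n / K <= V], so that an error [1 / K] on each of
    [n] factors stays of the order of [expR V]. *)
Let K := (n %/ V).+1.

(* With q = 1 / (8 K^2), sum_bin_le bounds the size of a 1/K-cover at 2n points by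
   (8 K^2)^V e^V; the distance to the cover costs at most another factor e^V. *)
Definition vc_entropy : R := V%:R * (2 + ln (8 * K%:R ^+ 2)).

(** With [ln 8 <= 7] and [ln K <= logp (n / V) + 1], the entropy is at most [V] times
    [11 + 2 * logp (n / V)], well below the dimension term. *)
Lemma vc_entropy_le : vc_entropy <= dimension_term R n V.
Proof.
have V0 : (0 : R) < V%:R by rewrite ltr0n.
have K0 : (0 : R) < K%:R by rewrite ltr0n.
rewrite /dimension_term mulrAC [leRHS]mulrC ler_pM2l//.
have lnK : ln (K%:R : R) <= logp (n%:R / V%:R) + 1.
  apply: le_trans (le_ln_addr1 _); last by rewrite divr_ge0.
  have nV0 : (0 : R) < n%:R / V%:R + 1 by rewrite ltr_wpDl// divr_ge0.
  rewrite ler_ln ?posrE//.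
  by rewrite -natr1 lerD2r ler_pdivlMr// -natrM ler_nat leq_divM.
have ln8 : ln (8 : R) <= 7.
  have := @le_ln1Dx R 7; rewrite (_ : 1 + 7 = 8); last by rewrite -(natrD _ 1 7).
  by apply; lra.
have lp0 : 0 <= logp (n%:R / V%:R : R) by rewrite le_max lexx.
rewrite lnM ?posrE ?exprn_gt0// lnXn// mulr2n; lra.
Qed.

Lemma vc_summax_le (J : finType) (g : J -> W -> R) (zs : seq (Z * Z)) :
  (forall j, F (g j)) -> size zs = n ->
  summax (symmetrize_all
      (fun j y z => sym_kernel (phi y (g j (wz y))) (phi z (g j (wz z)))) zs
    [:: fun=> 1]) (fun=> 1) <= expR vc_entropy.
Proof.
move=> Fg zsn.
have V0 : (0 : R) < V%:R by rewrite ltr0n.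
have K0 : (0 : R) < K%:R by rewrite ltr0n.
have nVK : n%:R / K%:R <= V%:R :> R.
  by rewrite ler_pdivrMr// -natrM ler_nat mulnC ltnW// ltn_ceil.
(* The cover must control both members of every pair, hence [2 * n] points. *)
pose s := unzip1 zs ++ unzip2 zs.
have ss : size s = (2 * n)%N by rewrite size_cat !size_map zsn mul2n addnn.
have [D cD hD] := @vc_subgraph_cover W Z R F V I wz phi J g (2 * n) K
  (fun i => nth point s i) vcF FI phi1 phi_qc Fg isT.
have hphi j z : `|phi z (g j (wz z))| <= 1 by rewrite ler_norml phi1//; exact: FI.
have close y j r : y \in s -> (forall i : 'I_(2 * n),
    `|phi (nth point s i) (g j (wz (nth point s i))) -
      phi (nth point s i) (g r (wz (nth point s i)))| <= K%:R^-1) ->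
    `|phi y (g j (wz y)) - phi y (g r (wz y))| <= K%:R^-1.
  move=> /(nthP point)[i]; rewrite ss => ilt <- h.
  exact: (h (Ordinal ilt)).
apply: le_trans (@summax_symmetrize_all R J Z _ _ _ (expR (3 * K%:R^-1 / 100)) D zs _ _) _.
- by move=> *; exact: expR_ge0.
- by move=> j x y; exact: sym_kernel_le1.
- exact: expR_ge0.
- move=> j; have [r rD hr] := hD j; exists r => // z zzs.
  have z1 : z.1 \in s by rewrite mem_cat map_f.
  have z2 : z.2 \in s by rewrite mem_cat map_f ?orbT.
  by split; apply: sym_kernel_close => //; exact: close.
rewrite zsn -expRM_natl.
apply: (@le_trans _ _ (expR V%:R * ((8 * K%:R ^+ 2) ^+ V * expR V%:R))).
  apply: ler_pM => //; rewrite ?expR_ge0//.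
    rewrite ler_expR (_ : n%:R * _ = n%:R / K%:R * (3 / 100)); last first.
      by field; exact: lt0r_neq0.
    by move: nVK V0; lra.
  (* There are [8 * n * K] test points, and [q] is chosen so that [q] times this number is
     [n / K <= V]. *)
  apply: le_trans (_ : (\sum_(i < V.+1) 'C(4 * (2 * n) * K, i))%:R <= _).
    by rewrite ler_nat.
  apply: le_trans (@sum_bin_le R _ _ (8 * K%:R ^+ 2)^-1 _ _) _.
  - by rewrite invr_gt0 mulr_gt0 ?exprn_gt0.
  - rewrite invf_le1 ?mulr_gt0 ?exprn_gt0//.
    have : (1 : R) <= K%:R by rewrite ler1n.
    by move=> K1; nra.
  rewrite exprVn invrK ler_pM2l ?exprn_gt0 ?mulr_gt0 ?exprn_gt0// ler_expR.
  rewrite (_ : (8 * K%:R ^+ 2)^-1 * _ = n%:R / K%:R)// !natrM; field.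
  exact: lt0r_neq0.
rewrite mulrCA -expRD (_ : V%:R + V%:R = V%:R * 2); last by ring.
by rewrite /vc_entropy [V%:R * (2 + _)]mulrDr [leRHS]expRD [leLHS]mulrC [expR (_ * ln _)]expRM_natl
  lnK// posrE mulr_gt0 ?exprn_gt0.
Qed.

End vc_kernel.

(** * Hellinger distance *)

(* With s = a + b, z = x - s/2 and w = f s, the difference of the two sides is
   bounded below by a positive definite quadratic form in (z, w). *)
Lemma hellinger_quad (R : realType) (f x s a b : R) : -1 <= f -> f <= 1 ->
  a = s * (1 - f) / 2 -> b = s * (1 + f) / 2 ->
  (f + f ^+ 2 / 10) * x ^+ 2 + 47 / 500 * (x - b) ^+ 2 + a ^+ 2 / 4 <=
  7 * (x - a) ^+ 2 + b ^+ 2 / 4.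
Proof.
move=> f1 f2 aE bE; rewrite -subr_ge0.
pose z := x - s / 2; pose w := f * s.
have -> : 7 * (x - a) ^+ 2 + b ^+ 2 / 4 -
    ((f + f ^+ 2 / 10) * x ^+ 2 + 47 / 500 * (x - b) ^+ 2 + a ^+ 2 / 4) =
  (3453 / 500 - f) * z ^+ 2 + 3047 / 500 * (z * w) +
    3453 / 2000 * w ^+ 2 - f ^+ 2 * x ^+ 2 / 10.
  by rewrite /z /w aE bE; field.
have f21 : f ^+ 2 <= 1 by nra.
(* Parallelogram identity for [f * x = f * z + w / 2] and [f * (x - s) = f * z - w / 2]. *)
have fx : f ^+ 2 * x ^+ 2 <= 2 * z ^+ 2 + w ^+ 2 / 2.
  have -> : 2 * z ^+ 2 + w ^+ 2 / 2 =
      f ^+ 2 * x ^+ 2 + ((f * (x - s)) ^+ 2 + 2 * (1 - f ^+ 2) * z ^+ 2).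
    by rewrite /z /w; field.
  rewrite lerDl addr_ge0 ?sqr_ge0// mulr_ge0 ?sqr_ge0// mulr_ge0//.
  by rewrite subr_ge0.
have fz : f * z ^+ 2 <= z ^+ 2 by rewrite ler_piMl ?sqr_ge0.
(* The remaining form is at least [5.706 z^2 + 6.094 z w + 1.6765 w^2]; the multiple of this square
   with the same cross term leaves nonnegative coefficients on [z ^+ 2] and [w ^+ 2]. *)
have zw : 0 <= (z + 27 / 50 * w) ^+ 2 by exact: sqr_ge0.
have e1 : (z + 27 / 50 * w) ^+ 2 = z ^+ 2 + 27 / 25 * (z * w) + 27 / 50 * (27 / 50) * w ^+ 2.
  by field.
rewrite {}e1 in zw.
have z0 := sqr_ge0 z; have w0 := sqr_ge0 w.
move: (z * w) (z ^+ 2) (w ^+ 2) (x ^+ 2) zw fz fx z0 w0 => *; lra.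
Qed.

Lemma measurable_pos_inv d (Y : measurableType d) (R : realType) (g : Y -> R) :
  (forall y, 0 < g y) -> measurable_fun setT g ->
  measurable_fun setT (fun y => (g y)^-1).
Proof.
move=> g0 mg; have -> : (fun y => (g y)^-1) = (fun y => expR (- ln (g y))).
  by apply/funext => y; rewrite expRN lnK// posrE.
apply: (@measurableT_comp _ _ _ _ _ _ (@expR R)) => //.
by apply: measurableT_comp => //; apply: measurableT_comp.
Qed.

Lemma measurable_sqrtr d (Y : measurableType d) (R : realType) (g : Y -> R) :
  measurable_fun setT g -> measurable_fun setT (fun y => Num.sqrt (g y)).
Proof.
move=> mg; apply: (measurableT_comp _ mg).
by apply: continuous_measurable_fun => x; exact: sqrt_continuous.
Qed.

Section hellinger_bound.
Context d (Y : measurableType d) (R : realType).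
Implicit Types (S Q : probability Y R).

Definition psi_sqrt_ratio (b a : R) : R := psi (er_map Num.sqrt (Defs.ratio b a)).

Lemma psi_sqrt_ratioE b a : 0 < a ->
  psi_sqrt_ratio b a = (Num.sqrt (b / a) - 1) / (Num.sqrt (b / a) + 1).
Proof. by move=> a0; rewrite /psi_sqrt_ratio /Defs.ratio gt_eqF. Qed.

Lemma psi_sqrt_ratio_bound b a : 0 < a -> -1 <= psi_sqrt_ratio b a <= 1.
Proof.
move=> a0; rewrite psi_sqrt_ratioE//; set t := Num.sqrt _.
have t0 : 0 <= t by exact: sqrtr_ge0.
have t1 : 0 < t + 1 by rewrite ltr_wpDl.
by rewrite ler_pdivlMr// ler_pdivrMr//; apply/andP; split; lra.
Qed.

Lemma measurable_psi_sqrt_ratio d' (Z : measurableType d') (g h : Z -> R) :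
  (forall z, 0 < h z) -> measurable_fun setT g -> measurable_fun setT h ->
  measurable_fun setT (fun z => psi_sqrt_ratio (g z) (h z)).
Proof.
move=> h0 mg mh; under eq_fun do rewrite psi_sqrt_ratioE//.
have mr : measurable_fun setT (fun z => Num.sqrt (g z / h z)).
  by apply: measurable_sqrtr; apply: measurable_funM => //; exact: measurable_pos_inv.
apply: measurable_funM; first exact: measurable_funB.
by apply: measurable_pos_inv => [z|]; [rewrite ltr_wpDl|exact: measurable_funD].
Qed.

(** Radon-Nikodym derivatives in the form that [hellingerE] takes: real-valued and nonnegative
    everywhere. *)
Lemma probability_densities S Q : exists (s q : Y -> R)
    (s0 : forall y, 0 <= s y) (ms : measurable_fun setT s)
    (q0 : forall y, 0 <= q y) (mq : measurable_fun setT q),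
  (forall A, measurable A -> S A = density (measure_sum S Q) s0 ms A) /\
  (forall A, measurable A -> Q A = density (measure_sum S Q) q0 mq A).
Proof.
have RN (N : probability Y R) : (forall A, (N A <= measure_sum S Q A)%E) ->
    exists (s : Y -> R) (s0 : forall y, 0 <= s y) (ms : measurable_fun setT s),
    forall A, measurable A -> N A = density (measure_sum S Q) s0 ms A.
  move=> Nm; have dom : N `<< measure_sum S Q.
    apply/null_content_dominatesP => A mA mA0.
    by apply/eqP; rewrite -measure_le0 -mA0 Nm.
  have [f [f0 ffin fint fE]] := radon_nikodym_sigma_finite dom.
  have s0 y : 0 <= fine (f y) by rewrite fine_ge0.
  have ms : measurable_fun setT (fun y => fine (f y)).
    by apply: measurableT_comp => //; exact: measurable_int fint.
  exists (fun y => fine (f y)), s0, ms => A mA; rewrite fE// /density.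
  by apply: eq_integral => y _; rewrite fineK.
have mE A : measure_sum S Q A = (S A + Q A)%E by exact: measure_addE.
have [s [s0 [ms sE]]] : exists (s : Y -> R) (s0 : forall y, 0 <= s y)
    (ms : measurable_fun setT s),
    forall A, measurable A -> S A = density (measure_sum S Q) s0 ms A.
  by apply: RN => A; rewrite mE leeDl.
have [q [q0 [mq qE]]] : exists (q : Y -> R) (q0 : forall y, 0 <= q y)
    (mq : measurable_fun setT q),
    forall A, measurable A -> Q A = density (measure_sum S Q) q0 mq A.
  by apply: RN => A; rewrite mE leeDr.
by exists s, q, s0, ms, q0, mq.
Qed.

(** The law [S] may be singular to [nu], so all densities are taken with respect to [S + Q]. The
    pointwise inequality [hellinger_quad] is then integrated; its terms in [q] and [q'] cancel, both
    having integral 1. *)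
Lemma hellinger_bound (nu : {measure set Y -> \bar R}) S Q Q' (r r' f : Y -> R)
    (r0 : forall y, 0 <= r y) (mr : measurable_fun setT r)
    (r'0 : forall y, 0 <= r' y) (mr' : measurable_fun setT r') :
  (forall y, 0 < r y) ->
  (forall A, measurable A -> Q A = density nu r0 mr A) ->
  (forall A, measurable A -> Q' A = density nu r'0 mr' A) ->
  (forall y, f y = psi_sqrt_ratio (r' y) (r y)) ->
  \int[S]_y (f y + f y ^+ 2 / 10) + 47 / 250 * hellinger S Q' ^+ 2 <=
    14 * hellinger S Q ^+ 2.
Proof.
move=> rgt0 QE Q'E fE.
have mf : measurable_fun setT f.
  by rewrite (funext fE); exact: measurable_psi_sqrt_ratio.
have [s [q [s0 [ms [q0 [mq [SE QE']]]]]]] := probability_densities S Q.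
set m := measure_sum S Q in SE QE'.
pose rho y := r' y / r y.
have rho0 y : 0 <= rho y by rewrite divr_ge0.
have mrho : measurable_fun setT rho.
  by apply: measurable_funM => //; exact: measurable_pos_inv.
pose q' y := rho y * q y.
have q'0 y : 0 <= q' y by rewrite mulr_ge0.
have mq' : measurable_fun setT q' by exact: measurable_funM.
(* Since [r] is positive, [Q'] has density [rho = r' / r] with respect to [Q], hence [rho * q] with
   respect to [m]. *)
have Q'E' A : measurable A -> Q' A = density m q'0 mq' A.
  move=> mA; rewrite Q'E// /density.
  transitivity (\int[density m q0 mq]_(y in A) (rho y)%:E)%E; last first.
    rewrite ge0_integral_density//; last first.
      by apply/measurable_EFinP; exact: measurable_funTS.
  transitivity (\int[density nu r0 mr]_(y in A) (rho y)%:E)%E; last first.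
    by apply: eq_measure_integral => B mB _; rewrite /= -QE// QE'.
  rewrite ge0_integral_density//; last first.
    by apply/measurable_EFinP; exact: measurable_funTS.
  by apply: eq_integral => y _; rewrite -EFinM /rho divfK ?gt_eqF.
rewrite (hellingerE SE QE') (hellingerE SE Q'E').
have int0 (g h : Y -> R) : 0 <= 2^-1 * \int[m]_y (Num.sqrt (g y) - Num.sqrt (h y)) ^+ 2.
  by rewrite mulr_ge0 ?invr_ge0// Rintegral_ge0// => y _; exact: sqr_ge0.
rewrite !sqr_sqrtr//.
have iprob (N : probability Y R) (g : Y -> R) (g0 : forall y, 0 <= g y)
    (mg : measurable_fun setT g) :
    (forall A, measurable A -> N A = density m g0 mg A) ->
    m.-integrable setT (EFin \o g) /\ \int[m]_y g y = 1.
  move=> NE; have N1 : (\int[m]_y (g y)%:E = 1)%E.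
    by rewrite -(@probability_setT _ _ _ N) NE.
  split; last by rewrite /Rintegral N1.
  apply/integrableP; split; first exact/measurable_EFinP.
  under eq_integral do rewrite /= ger0_norm//.
  by rewrite N1 ltry.
have [iS iS1] := iprob S s s0 ms SE.
have [iq iq1] := iprob Q q q0 mq QE'.
have [iq' iq'1] := iprob Q' q' q'0 mq' Q'E'.
have iH (g : Y -> R) : (forall y, 0 <= g y) -> measurable_fun setT g ->
    m.-integrable setT (EFin \o g) ->
    m.-integrable setT (fun y => ((Num.sqrt (s y) - Num.sqrt (g y)) ^+ 2)%:E).
  move=> g0 mg ig; apply: (le_integrable measurableT _ _ (integrableD measurableT iS ig)).
    apply/measurable_EFinP; apply: measurable_funX; apply: measurable_funB; exact: measurable_sqrtr.
  move=> y _ /=; rewrite lee_fin !ger0_norm ?sqr_ge0 ?addr_ge0//.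
  rewrite -{2}(sqr_sqrtr (s0 y)) -{2}(sqr_sqrtr (g0 y)).
  rewrite -subr_ge0 (_ : _ - _ = 2 * (Num.sqrt (s y) * Num.sqrt (g y))); last by ring.
  by rewrite !mulr_ge0 ?sqrtr_ge0.
have f1 y : -1 <= f y <= 1 by rewrite fE psi_sqrt_ratio_bound.
pose F y := f y + f y ^+ 2 / 10.
have mF : measurable_fun setT F.
  by apply: measurable_funD => //; apply: measurable_funM => //; exact: measurable_funX.
have F2 y : `|F y| <= 2.
  by have := f1 y; rewrite /F !ler_norml => /andP[? ?]; nra.
have iFs : m.-integrable setT (fun y => (F y * s y)%:E).
  apply: (le_integrable measurableT _ _ (integrableZl measurableT 2 iS)).
    by apply/measurable_EFinP; exact: measurable_funM.
  move=> y _ /=; rewrite lee_fin !normrM (ger0_norm (s0 y)) ler_wpM2r//.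
  by rewrite [leRHS]ger0_norm.
have -> : \int[S]_y (f y + f y ^+ 2 / 10) = \int[m]_y (F y * s y).
  rewrite /Rintegral; congr fine.
  transitivity (\int[density m s0 ms]_y (F y)%:E)%E.
    by apply: eq_measure_integral => B mB _; exact: SE.
  rewrite integral_density//; last exact/measurable_EFinP.
(* Here [hellinger_quad] is used with [a = sqrt q], [b = sqrt q'] and sum [sqrt q * (sqrt rho + 1)];
   [psi] is exactly [(b - a) / (b + a)]. *)
have key y : F y * s y + 47 / 500 * (Num.sqrt (s y) - Num.sqrt (q' y)) ^+ 2 + 4^-1 * q y <=
    7 * (Num.sqrt (s y) - Num.sqrt (q y)) ^+ 2 + 4^-1 * q' y.
  have sq : Num.sqrt (q' y) = Num.sqrt (rho y) * Num.sqrt (q y) by rewrite sqrtrM.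
  have t1 : Num.sqrt (rho y) + 1 != 0 by rewrite gt_eqF// ltr_wpDl.
  rewrite -(sqr_sqrtr (s0 y)) -(sqr_sqrtr (q0 y)) -(sqr_sqrtr (q'0 y)).
  rewrite !sqrtr_sqr !(ger0_norm (sqrtr_ge0 _)).
  have /andP[fy1 fy2] := f1 y.
  have := @hellinger_quad R (f y) (Num.sqrt (s y)) (Num.sqrt (q y) * (Num.sqrt (rho y) + 1))
    (Num.sqrt (q y)) (Num.sqrt (q' y)) fy1 fy2.
  have := fE y; rewrite psi_sqrt_ratioE// -/(rho y) sq /F => fyE h.
  move: (Num.sqrt (rho y)) t1 fyE h => t t1 fyE h.
  rewrite ![4^-1 * _]mulrC; apply: h; rewrite fyE; by field.
have iD (g h : Y -> R) : m.-integrable setT (EFin \o g) ->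
    m.-integrable setT (EFin \o h) -> m.-integrable setT (EFin \o (fun y => g y + h y)).
  by move=> ig ih; exact: (integrableD measurableT ig ih).
have iZ (c : R) (g : Y -> R) : m.-integrable setT (EFin \o g) ->
    m.-integrable setT (EFin \o (fun y => c * g y)).
  by move=> ig; exact: (integrableZl measurableT c ig).
have iq7 := iH q q0 mq iq; have iq'7 := iH q' q'0 mq' iq'.
have : \int[m]_y (F y * s y + 47 / 500 * (Num.sqrt (s y) - Num.sqrt (q' y)) ^+ 2 + 4^-1 * q y)
    <= \int[m]_y (7 * (Num.sqrt (s y) - Num.sqrt (q y)) ^+ 2 + 4^-1 * q' y).
  apply: le_Rintegral => //.
    by apply: (iD); [apply: (iD) => //|]; exact: iZ.
  by apply: (iD); exact: iZ.
rewrite !RintegralD//; try exact: iZ; last by apply: (iD) => //; exact: iZ.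
rewrite !RintegralZl// iq1 iq'1.
move: (\int[m]_y (F y * s y)) (\int[m]_y (Num.sqrt (s y) - Num.sqrt (q' y)) ^+ 2)
  (\int[m]_y (Num.sqrt (s y) - Num.sqrt (q y)) ^+ 2) => u1 u2 u3; lra.
Qed.

End hellinger_bound.

Section real_integrand.
Context d (T : measurableType d) (R : realType) (mu : {measure set T -> \bar R}).
Variables (D : set T) (mD : measurable D) (f g : T -> R).
Hypotheses (f0 : forall x, 0 <= f x) (mf : measurable_fun setT f).
Hypotheses (g0 : forall x, 0 <= g x) (mg : measurable_fun setT g).

Let mEf : measurable_fun D (EFin \o f).
Proof. by apply/measurable_EFinP; exact: measurable_funTS. Qed.

Let mEg : measurable_fun D (EFin \o g).
Proof. by apply/measurable_EFinP; exact: measurable_funTS. Qed.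

Lemma ge0_integralD_EFin : (\int[mu]_(x in D) (f x + g x)%:E =
  \int[mu]_(x in D) (f x)%:E + \int[mu]_(x in D) (g x)%:E)%E.
Proof.
under eq_integral do rewrite EFinD.
by rewrite ge0_integralD// => x _; rewrite lee_fin.
Qed.

Lemma ge0_integralM_EFin (c : R) : 0 <= c ->
  (\int[mu]_(x in D) (c * f x)%:E = c%:E * \int[mu]_(x in D) (f x)%:E)%E.
Proof.
move=> c0; under eq_integral do rewrite EFinM.
by rewrite ge0_integralZl_EFin// => x _; rewrite lee_fin.
Qed.

Lemma le_integral_EFin : (forall x, f x <= g x) ->
  (\int[mu]_(x in D) (f x)%:E <= \int[mu]_(x in D) (g x)%:E)%E.
Proof.
by move=> fg; apply: ge0_le_integral => // x _; rewrite lee_fin.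
Qed.

End real_integrand.

(** * Measurability for the Hellinger Borel sigma-algebra *)

Section hellinger_measurability.
Context d (Y : measurableType d) (R : realType).
Implicit Types (P Q : probability Y R).

(** Integrating the pointwise bound [pw] over [B]: its error terms contribute [e], as the integral
    of [D] is at most [2 * e ^+ 2], and [2 * e], as [s + q] has integral 2. *)
Lemma hellinger_close P Q B (e : R) : measurable B -> hellinger P Q < e ->
  (P B <= Q B + (3 * e)%:E)%E.
Proof.
move=> mB he; have [s [q [s0 [ms [q0 [mq [SE QE]]]]]]] := probability_densities P Q.
set m := measure_sum P Q in SE QE.
have e0 : 0 < e by rewrite (le_lt_trans _ he)// sqrtr_ge0.
move: he; rewrite (hellingerE SE QE) => he.
pose D y := (Num.sqrt (s y) - Num.sqrt (q y)) ^+ 2.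
have mD : measurable_fun setT D.
  by apply: measurable_funX; apply: measurable_funB; exact: measurable_sqrtr.
have D0 y : 0 <= D y by exact: sqr_ge0.
have iprob (N : probability Y R) (g : Y -> R) (g0 : forall y, 0 <= g y)
    (mg : measurable_fun setT g) :
    (forall A, measurable A -> N A = density m g0 mg A) ->
    (\int[m]_y (g y)%:E = 1)%E.
  by move=> NE; rewrite -(@probability_setT _ _ _ N) NE.
have s1 := iprob P s s0 ms SE; have q1 := iprob Q q q0 mq QE.
have mE (g : Y -> R) A : measurable_fun setT g -> measurable_fun A (EFin \o g).
  by move=> mg; apply/measurable_EFinP; exact: measurable_funTS.
have Dle2 : (\int[m]_y (D y)%:E <= (2 * e ^+ 2)%:E)%E.
  (* Finiteness is established first: [hellinger] is defined by a real integral, which would read 0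
     for an infinite one. *)
  have iD : (\int[m]_y (D y)%:E <= 2%:E)%E.
    have -> : (2%:E = \int[m]_y (s y + q y)%:E)%E.
      by rewrite ge0_integralD_EFin// s1 q1.
    apply: le_integral_EFin => // [|y]; first exact: measurable_funD.
    rewrite /D.
    rewrite -{2}(sqr_sqrtr (s0 y)) -{2}(sqr_sqrtr (q0 y)).
    rewrite -subr_ge0 (_ : _ - _ = 2 * (Num.sqrt (s y) * Num.sqrt (q y))); last by ring.
    by rewrite !mulr_ge0 ?sqrtr_ge0.
  have iD0 : (0 <= \int[m]_y (D y)%:E)%E by apply: integral_ge0 => y _; rewrite lee_fin.
  have ifin : (\int[m]_y (D y)%:E)%E \is a fin_num.
    by rewrite ge0_fin_numE// (le_lt_trans iD)// ltry.
  rewrite -(fineK ifin) lee_fin.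
  have h0 : 0 <= 2^-1 * fine (\int[m]_y (D y)%:E)%E.
    by rewrite mulr_ge0 ?invr_ge0// fine_ge0.
  have := sqr_sqrtr h0; move: he; rewrite /Rintegral -/D.
  move: (Num.sqrt _) (sqrtr_ge0 (2^-1 * fine (\int[m]_y (D y)%:E)%E)) => t t0 te.
  by move: (fine _) => u tu; nra.
(* Young's inequality for [s - q = (a - b) * (a + b)] with parameter [e], where [a] and [b] are the
   square roots; the difference of the two sides is the sum of squares in [h]. *)
have pw y : s y <= q y + (D y / (2 * e) + e * (s y + q y)).
  rewrite /D -{1 3}(sqr_sqrtr (s0 y)) -{1 3}(sqr_sqrtr (q0 y)).
  move: (Num.sqrt (s y)) (Num.sqrt (q y)) => a b.
  have h : 0 <= (((a - b) - e * (a + b)) ^+ 2 + e ^+ 2 * (a - b) ^+ 2) / (2 * e).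
    rewrite divr_ge0//; last by rewrite mulr_ge0// ltW.
    by rewrite addr_ge0 ?sqr_ge0// mulr_ge0 ?sqr_ge0.
  rewrite -subr_ge0; apply: le_trans h _; rewrite le_eqVlt; apply/orP; left; apply/eqP.
  by field; exact: lt0r_neq0.
pose G y := D y / (2 * e) + e * (s y + q y).
have G0 y : 0 <= G y.
  have e0' := ltW e0; rewrite /G; apply: addr_ge0.
    by apply: divr_ge0 => //; exact: mulr_ge0.
  by apply: mulr_ge0 => //; exact: addr_ge0.
have mG : measurable_fun setT G.
  by apply: measurable_funD; apply: measurable_funM => //; exact: measurable_funD.
rewrite SE// QE// /density.
apply: (@le_trans _ _ (\int[m]_(y in B) (q y + G y)%:E)%E).
  by apply: le_integral_EFin => //; exact: measurable_funD.
rewrite ge0_integralD_EFin//.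
rewrite leeD2l//; apply: (@le_trans _ _ (\int[m]_y (G y)%:E)%E).
  by apply: ge0_subset_integral => //; [exact: mE|move=> y _; rewrite lee_fin].
have i0 : 0 <= (2 * e)^-1 by rewrite invr_ge0 mulr_ge0 ?ltW.
have iG : (\int[m]_y (G y)%:E = ((2 * e)^-1)%:E * \int[m]_y (D y)%:E + e%:E * (1 + 1))%E.
  have sq0 y : 0 <= s y + q y by rewrite addr_ge0.
  have msq : measurable_fun setT (fun y => s y + q y) by exact: measurable_funD.
  have esq0 y : 0 <= e * (s y + q y) by rewrite mulr_ge0// ltW.
  have mesq : measurable_fun setT (fun y => e * (s y + q y)) by exact: measurable_funM.
  have iD0 y : 0 <= (2 * e)^-1 * D y by rewrite mulr_ge0.
  have miD : measurable_fun setT (fun y => (2 * e)^-1 * D y) by exact: measurable_funM.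
  under eq_integral do rewrite /G [D _ / _]mulrC.
  rewrite ge0_integralD_EFin// !ge0_integralM_EFin//; last exact: ltW.
  by rewrite ge0_integralD_EFin// s1 q1.
rewrite iG; apply: (@le_trans _ _ (((2 * e)^-1)%:E * (2 * e ^+ 2)%:E + e%:E * (1 + 1))%E).
  by rewrite leeD2r// lee_wpmul2l// lee_fin.
rewrite -[(1 + 1)%E]/((1 + 1)%:E) -!EFinM -EFinD lee_fin le_eqVlt; apply/orP; left; apply/eqP.
by field; exact: lt0r_neq0.
Qed.

(** The set of [P] with [r < P B] is Hellinger-open: by [hellinger_close], the radius
    [(P B - r) / 4] costs at most three quarters of the gap. *)
Lemma hellinger_measurable_kernel d' (W : measurableType d') (K : W -> probability Y R) B :
  hellinger_measurable K -> measurable B -> measurable_fun setT (fun w => K w B).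
Proof.
move=> mK mB; apply: (measurability _ (ErealGenOInfty.measurableE R)) => _ /= -[_ [r ->] <-].
rewrite setTI (_ : _ @^-1` _ = K @^-1` [set P | (r%:E < P B)%E]); last first.
  by apply/seteqP; split => w /=; rewrite in_itv/= andbT.
apply: mK.
apply: sub_sigma_algebra => P /=; rewrite -(fineK (fin_num_measure P _ mB)) lte_fin => rP.
have e0 : 0 < (fine (P B) - r) / 4 by rewrite divr_gt0// subr_gt0.
exists ((fine (P B) - r) / 4) => // Q /(hellinger_close mB).
rewrite -(fineK (fin_num_measure P _ mB)) -(fineK (fin_num_measure Q _ mB)) /=.
rewrite -EFinD lee_fin lte_fin; lra.
Qed.

End hellinger_measurability.

(** * Joint law of a covariate and a response *)

Section disintegration.
Context dW (TW : measurableType dW) dY (TY : measurableType dY) (R : realType).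
Variables (K : TW -> probability TY R) (p : probability TW R).
Hypothesis mK : forall B, measurable B -> measurable_fun setT (fun w => K w B).

(** A copy of [K] with the measurability proof as an argument, so that kernel instances can be
    attached to it. *)
Definition cond_kernel (mK : forall B, measurable B -> measurable_fun setT (fun w => K w B))
  (w : TW) : {measure set TY -> \bar R} := K w.

HB.instance Definition _ :=
  @isKernel.Build _ _ TW TY R (cond_kernel mK) mK.

Let cond_kernelT w : cond_kernel mK w [set: TY] = 1%E.
Proof. exact: probability_setT. Qed.

HB.instance Definition _ :=
  @Kernel_isProbability.Build _ _ TW TY R (cond_kernel mK) cond_kernelT.

Lemma measurable_cond_integral (F : TW * TY -> \bar R) :
  (forall z, 0 <= F z)%E -> measurable_fun setT F ->
  measurable_fun setT (fun w => \int[K w]_y F (w, y))%E.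
Proof.
move=> F0 mF.
exact: (@measurable_fun_integral_finite_kernel _ _ TW TY R F (cond_kernel mK) F0 mF).
Qed.

Definition pair_at (w : TW) (y : TY) : TW * TY := (w, y).

HB.instance Definition _ (w : TW) :=
  isMeasurableFun.Build _ _ _ _ (pair_at w) (pair1_measurable w).

(* The joint law is the image of the kernel composition: w is drawn from p,
   then (w, y) with y drawn from K w. *)
Definition joint_kernel (mK : forall B, measurable B -> measurable_fun setT (fun w => K w B))
    (z : unit * TW) : {measure set (TW * TY)%type -> \bar R} :=
  distribution (K z.2) (pair_at z.2).

Let measurable_joint_kernel A : measurable A ->
  measurable_fun setT (joint_kernel mK ^~ A).
Proof.
move=> mA.
have mKA : measurable_fun setT (fun w => K w (xsection A w)).
  have := @measurable_fun_xsection_finite_kernel _ _ TW TY R (cond_kernel mK) A.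
  by apply; rewrite inE.
rewrite (_ : joint_kernel mK ^~ A = (fun w => K w (xsection A w)) \o snd).
  exact: measurableT_comp.
apply/funext => z; rewrite /= /joint_kernel /distribution /pushforward.
by congr (K _ _); apply/seteqP; split => y /=; rewrite /xsection /= inE.
Qed.

HB.instance Definition _ :=
  @isKernel.Build _ _ (unit * TW)%type (TW * TY)%type R (joint_kernel mK) measurable_joint_kernel.

Let joint_kernelT z : joint_kernel mK z setT = 1%E.
Proof. exact: probability_setT. Qed.

HB.instance Definition _ :=
  @Kernel_isProbability.Build _ _ _ _ R (joint_kernel mK) joint_kernelT.

(** The composed kernel [k] satisfies the formula by construction, and [mu] coincides with it
    because the two agree on measurable rectangles and are finite. *)
Lemma integral_disintegration (mu : {measure set (TW * TY)%type -> \bar R})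
    (F : TW * TY -> \bar R) :
  (forall A B, measurable A -> measurable B ->
    mu (A `*` B) = \int[p]_(w in A) K w B)%E ->
  (forall z, 0 <= F z)%E -> measurable_fun setT F ->
  (\int[mu]_z F z = \int[p]_w \int[K w]_y F (w, y))%E.
Proof.
move=> muE F0 mF.
pose l : unit -> pprobability TW R := fun=> p.
have ml : measurable_fun setT l by exact: measurable_cst.
pose k := kcomp (kprobability ml) (joint_kernel mK) tt.
have kE : (\int[k]_z F z = \int[p]_w \int[K w]_y F (w, y))%E.
  rewrite /k integral_kcomp//; apply: eq_integral => w _.
  by rewrite ge0_integral_distribution.
rewrite -kE; apply: eq_measure_integral => A mA _.
apply: (measure_unique
  [set C | exists A B, [/\ measurable A, measurable B & C = A `*` B]] (fun=> setT)) => //.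
- rewrite measurable_prod_measurableType; congr (<<s _ >>).
  apply/seteqP; split => [_ [B mB [C mC <-]]|_ [B [C [mB mC ->]]]].
    by exists B, C.
  by exists B => //; exists C.
- move=> _ _ [A1 [B1 [mA1 mB1 ->]]] [A2 [B2 [mA2 mB2 ->]]].
  exists (A1 `&` A2), (B1 `&` B2); split; [exact: measurableI..|].
  by rewrite -setXI.
- by move=> _; exists setT, setT; split => //; rewrite setXTT.
- by rewrite bigcup_const//; exists 0%N.
- move=> _ [B [C [mB mC ->]]]; rewrite muE// /k /= /kcomp /kprobability /=.
  rewrite integral_mkcond; apply: eq_integral => w _.
  rewrite /joint_kernel /= /distribution /pushforward patchE.
  have [wB|wB] := boolP (w \in B).
    by congr (K w _); apply/seteqP; split => y /=; [split=> //; exact: set_mem|case].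
  rewrite (_ : _ @^-1` _ = set0) ?measure0//.
  apply/seteqP; split => y //= [] Bw _; by move/negP: wB; apply; rewrite inE.
- move=> _; rewrite -setXTT muE//.
  rewrite (le_lt_trans (_ : _ <= \int[p]_w cst 1 w)%E)//.
    apply: ge0_le_integral => // [|w _]; first exact: mK.
    exact: probability_le1.
  by rewrite integral_cst// [X in (_ * X)%E]probability_setT mule1 ltry.
Qed.

End disintegration.

(** Shifting a bounded function by its bound gives access to results on nonnegative integrands. *)
Lemma integral_addr_cst d (T : measurableType d) (R : realType) (p : probability T R)
    (phi : T -> R) (b : R) : measurable_fun setT phi -> (forall x, `|phi x| <= b) ->
  (\int[p]_x (phi x + b)%:E = (\int[p]_x phi x + b)%:E)%E.
Proof.
move=> mphi phib.
have b0 : 0 <= b by rewrite (le_trans _ (phib point)).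
have iphi : p.-integrable setT (EFin \o phi) by exact: bounded_integrable mphi phib.
under eq_integral do rewrite EFinD.
rewrite integralD//; last first.
  by apply: (@bounded_integrable _ _ _ _ (cst b) b) => // x; rewrite ger0_norm.
rewrite integral_cst// [X in (_ * X)%E]probability_setT mule1 EFinD fineK//.
exact: integrable_fin_num.
Qed.

(** * Lower integrals *)

Section lower_integral.
Context d (T : measurableType d) (R : realType) (p : probability T R).

Import HBNNSimple.

(** The integral of a nonnegative function is a supremum over the simple functions below it, which
    is monotone for arbitrary functions. *)
Lemma le_integral_nonneg (f g : T -> R) : (forall x, 0 <= f x) -> (forall x, 0 <= g x) ->
  (forall x, f x <= g x) -> (\int[p]_x (f x)%:E <= \int[p]_x (g x)%:E)%E.
Proof.
move=> f0 g0 fg.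
rewrite !ge0_integralTE//; [|by move=> x; rewrite lee_fin..].
apply: ereal_sup_le => _ [h hf <-]; exists h => // x.
by rewrite (le_trans (hf x))// lee_fin.
Qed.

(* The functions f and g need not be measurable: their integrals are then
   lower integrals, which are superadditive. *)
Lemma le_integral_lower (phi f g : T -> R) (b c C : R) :
  measurable_fun setT phi -> (forall x, `|phi x| <= b) ->
  (forall x, 0 <= f x) -> (forall x, 0 <= g x) -> 0 < c -> 0 < C ->
  (forall x, phi x + c * f x <= C * g x) ->
  ((\int[p]_x phi x)%:E + c%:E * \int[p]_x (f x)%:E <= C%:E * \int[p]_x (g x)%:E)%E.
Proof.
move=> mphi phib f0 g0 c0 C0 h.
have intg0 : (0 <= \int[p]_x (g x)%:E)%E by apply: integral_ge0 => x _; rewrite lee_fin.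
have [goo|] := eqVneq (\int[p]_x (g x)%:E)%E +oo%E.
  by rewrite goo gt0_muley ?lte_fin// leey.
rewrite -ltey -ge0_fin_numE// => gfin.
have b0 : 0 <= b by rewrite (le_trans _ (phib point)).
have phib0 x : 0 <= phi x + b.
  by have := phib x; rewrite ler_norml => /andP[? _]; lra.
have mphib : measurable_fun setT (fun x => phi x + b) by exact: measurable_funD.
have intb (r : R) : (\int[p]_x r%:E = r%:E)%E.
  by rewrite integral_cst// [X in (_ * X)%E]probability_setT mule1.
have iphib := integral_addr_cst p mphi phib.
rewrite -(fineK gfin).
have key (s : {nnsfun T >-> R}) : (forall x, s x <= f x) ->
    (c%:E * sintegral p s <= (C * fine (\int[p]_x (g x)%:E) - \int[p]_x phi x)%:E)%E.
  move=> sf; rewrite -integralT_nnsfun.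
  (* A measurable minorant of [g], built from a simple minorant [s] of [f]: linearity is applied to
     [u] and [s] only. *)
  pose u x := Num.max 0 (phi x + c * s x) / C.
  have u0 x : 0 <= u x by apply: divr_ge0; [rewrite le_max lexx|exact: ltW].
  have ms : measurable_fun setT s by [].
  have mu : measurable_fun setT u.
    apply: measurable_funM => //; apply: measurable_maxr => //.
    by apply: measurable_funD => //; exact: measurable_funM.
  have ug x : u x <= g x.
    rewrite ler_pdivrMr// [leRHS]mulrC ge_max mulr_ge0 ?(ltW C0)//=.
    by rewrite (le_trans _ (h x))// lerD2l ler_pM2l.
  have cs0 x : 0 <= c * s x by rewrite mulr_ge0 ?(ltW c0).
  have mcs : measurable_fun setT (fun x => c * s x) by exact: measurable_funM.
  have Cu0 x : 0 <= C * u x by rewrite mulr_ge0 ?(ltW C0).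
  have mCu : measurable_fun setT (fun x => C * u x) by exact: measurable_funM.
  have : (\int[p]_x (c * s x + (phi x + b))%:E <= \int[p]_x (C * u x + b)%:E)%E.
    apply: le_integral_EFin => //.
    - by move=> x; exact: addr_ge0.
    - exact: measurable_funD.
    - exact: measurable_funD.
    move=> x; rewrite addrA lerD2r /u [C * _]mulrC divfK ?gt_eqF//.
    by rewrite addrC le_max lexx orbT.
  have mcb : measurable_fun [set: T] (fun=> b) by exact: measurable_cst.
  rewrite (ge0_integralD_EFin p measurableT cs0 mcs phib0 mphib).
  rewrite (ge0_integralD_EFin p measurableT Cu0 mCu (fun=> b0) mcb) iphib intb.
  rewrite (ge0_integralM_EFin p measurableT _ ms (ltW c0))//.
  rewrite (ge0_integralM_EFin p measurableT u0 mu (ltW C0)) => le1.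
  have le2 : (C%:E * \int[p]_x (u x)%:E <= (C * fine (\int[p]_x (g x)%:E))%:E)%E.
    rewrite EFinM fineK//; apply: lee_wpmul2l; first by rewrite lee_fin ltW.
    exact: le_integral_nonneg.
  have := le_trans le1 (leeD2r b%:E le2); rewrite -EFinD.
  case: (c%:E * _)%E => [r||]; [|by rewrite addye// !leye_eq|by move=> _; exact: leNye].
  by rewrite -EFinD !lee_fin; lra.
rewrite -EFinM -leeBrDl// -EFinB -lee_pdivlMl//.
rewrite ge0_integralTE//.
apply: ge_ereal_sup => _ [s sf <-]; rewrite lee_pdivlMl//; apply: key => x.
by rewrite -lee_fin.
Qed.

End lower_integral.

(** * One-parameter exponential families *)

(** Averaging the tangent bound at the barycentre [m] over the two points; the linear parts
    cancel. *)
Lemma expR_convex (R : realType) (t x y : R) : 0 <= t -> t <= 1 ->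
  expR (t * x + (1 - t) * y) <= t * expR x + (1 - t) * expR y.
Proof.
move=> t0 t1; set m := t * x + _.
have h z : expR m * (1 + (z - m)) <= expR z.
  have -> : expR z = expR m * expR (z - m) by rewrite -expRD addrC subrK.
  by rewrite ler_pM2l ?expR_gt0// expR_ge1Dx.
have := ler_wpM2l t0 (h x).
have := ler_wpM2l (_ : 0 <= 1 - t) (h y); rewrite subr_ge0 => /(_ t1).
have : t * (expR m * (1 + (x - m))) + (1 - t) * (expR m * (1 + (y - m))) = expR m.
  by rewrite /m; ring.
lra.
Qed.

Lemma convex_between (R : realType) (a b c : R) : (a <= b <= c) || (c <= b <= a) ->
  exists t, [/\ 0 <= t, t <= 1 & b = t * a + (1 - t) * c].
Proof.
have [->|ac] := eqVneq a c.
  by rewrite orbb => /le_anti ->; exists 0; split => //; ring.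
have ac0 : a - c != 0 by rewrite subr_eq0.
have e : b = (b - c) / (a - c) * a + (1 - (b - c) / (a - c)) * c by field.
move=> h; exists ((b - c) / (a - c)); split => //.
- move: h => /orP[] /andP[h1 h2]; first by rewrite mulr_le0 ?invr_le0 ?subr_le0// (le_trans h1).
  by rewrite divr_ge0 ?subr_ge0// (le_trans h1).
- move: ac; rewrite neq_lt => /orP[ac|ac].
    rewrite ler_ndivrMr ?subr_lt0// mul1r; move: h => /orP[] /andP[h1 h2]; lra.
  rewrite ler_pdivrMr ?subr_gt0// mul1r; move: h => /orP[] /andP[h1 h2]; lra.
Qed.

Lemma le_psi_sqrt_ratio (R : realType) (a b b' : R) : 0 < a -> 0 <= b -> b <= b' ->
  psi_sqrt_ratio b a <= psi_sqrt_ratio b' a.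
Proof.
move=> a0 b0 bb'; rewrite !psi_sqrt_ratioE//.
have : Num.sqrt (b / a) <= Num.sqrt (b' / a).
  by apply: ler_wsqrtr; rewrite ler_pM2r ?invr_gt0.
move: (sqrtr_ge0 (b / a)); move: (Num.sqrt (b / a)) (Num.sqrt (b' / a)) => x x' x0 xx'.
rewrite ler_pdivrMr; last by lra.
rewrite mulrAC ler_pdivlMr; last by lra.
nra.
Qed.

(** The strict sublevel sets of [v] within [I] are intervals, hence Borel. *)
Lemma measurable_quasiconvex_comp d (T : measurableType d) (R : realType) (I : set R)
    (v : R -> R) (g : T -> R) : is_interval I ->
  (forall x y z, I x -> I y -> I z -> x <= y <= z -> v y <= Num.max (v x) (v z)) ->
  measurable_fun setT g -> (forall t, I (g t)) -> measurable_fun setT (v \o g).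
Proof.
move=> itvI v_qc mg Ig.
apply: (measurability _ (RGenInftyO.measurableE R)) => _ /= -[_ [r ->] <-].
rewrite setTI (_ : _ @^-1` _ = setT `&` g @^-1` [set x | I x /\ v x < r]); last first.
  by apply/seteqP; split => t /=; rewrite in_itv/=; [split|case=> _ []].
apply: mg => //; apply: is_interval_measurable.
move=> x z [Ix vx] [Iz vz] y xyz.
have Iy : I y by exact: itvI xyz.
split=> //; apply: le_lt_trans (v_qc x y z Ix Iy Iz xyz) _.
by rewrite gt_max vx.
Qed.

Lemma le1_of_density_mixture d (Y : measurableType d) (R : realType)
    (nu : {measure set Y -> \bar R}) (r1 r2 r3 : Y -> R) (e t : R) :
  (forall y, 0 <= r1 y) -> measurable_fun setT r1 -> (\int[nu]_y (r1 y)%:E = 1)%E ->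
  (forall y, 0 <= r2 y) -> measurable_fun setT r2 -> (\int[nu]_y (r2 y)%:E = 1)%E ->
  (forall y, 0 <= r3 y) -> measurable_fun setT r3 -> (\int[nu]_y (r3 y)%:E = 1)%E ->
  0 <= e -> 0 <= t -> t <= 1 ->
  (forall y, e * r2 y <= t * r1 y + (1 - t) * r3 y) -> e <= 1.
Proof.
move=> r10 m1 i1 r20 m2 i2 r30 m3 i3 e0 t0 t1 h.
have t1' : 0 <= 1 - t by rewrite subr_ge0.
have p1 y : 0 <= t * r1 y by exact: mulr_ge0.
have p3 y : 0 <= (1 - t) * r3 y by exact: mulr_ge0.
have p2 y : 0 <= e * r2 y by exact: mulr_ge0.
have m1' : measurable_fun setT (fun y => t * r1 y) by exact: measurable_funM.
have m2' : measurable_fun setT (fun y => e * r2 y) by exact: measurable_funM.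
have m3' : measurable_fun setT (fun y => (1 - t) * r3 y) by exact: measurable_funM.
have := le_integral_EFin nu measurableT p2 m2' (measurable_funD m1' m3') h.
rewrite (ge0_integralD_EFin nu measurableT p1 m1' p3 m3').
rewrite (ge0_integralM_EFin nu measurableT r10 m1 t0) i1.
rewrite (ge0_integralM_EFin nu measurableT r20 m2 e0) i2.
rewrite (ge0_integralM_EFin nu measurableT r30 m3 t1') i3.
by rewrite !mule1 -EFinD lee_fin addrC subrK.
Qed.

Section exponential_family_facts.
Context d (Y : measurableType d) (R : realType).
Variables (nu : {measure set Y -> \bar R}) (T : {mfun Y >-> R}) (u : R -> R).
Variables (I : set R) (itvI : is_interval I).
Hypothesis monou : (forall x y, I x -> I y -> x < y -> u x < u y) \/
           (forall x y, I x -> I y -> x < y -> u y < u x).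
Hypothesis finB : forall g, I g -> log_partition nu T u g \is a fin_num.

Let B g := fine (log_partition nu T u g).

Lemma exp_density_gt0 g y : 0 < exp_density nu T u g y.
Proof. exact: expR_gt0. Qed.

Lemma integral_exp_density g : I g -> (\int[nu]_y (exp_density nu T u g y)%:E = 1)%E.
Proof.
move=> Ig; rewrite -(@probability_setT _ _ _ (exp_prob nu T u g)).
by rewrite exp_probE// finB.
Qed.

(** Monotonicity of [u] makes [u g2] a barycentre of [u g1] and [u g3], and the log-partition
    function is convex in the natural parameter. *)
Lemma exp_density_intermediate g1 g2 g3 : I g1 -> I g2 -> I g3 -> g1 <= g2 <= g3 ->
  exists t, [/\ 0 <= t, t <= 1, u g2 = t * u g1 + (1 - t) * u g3 &
    B g2 <= t * B g1 + (1 - t) * B g3].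
Proof.
move=> I1 I2 I3 /andP[g12 g23].
have [t [t0 t1 ut]] : exists t, [/\ 0 <= t, t <= 1 & u g2 = t * u g1 + (1 - t) * u g3].
  apply: convex_between; apply/orP; case: monou => mu; [left|right].
    have mle x y' : I x -> I y' -> x <= y' -> u x <= u y'.
      by move=> Ix Iy; rewrite le_eqVlt => /orP[/eqP ->//|/(mu _ _ Ix Iy)/ltW].
    by rewrite !mle.
  have mle x y' : I x -> I y' -> x <= y' -> u y' <= u x.
    by move=> Ix Iy; rewrite le_eqVlt => /orP[/eqP ->//|/(mu _ _ Ix Iy)/ltW].
  by rewrite !mle.
exists t; split => //; set c := _ + _.
have dE g y : exp_density nu T u g y = expR (u g * T y - B g) by [].
have d0 g y : 0 <= exp_density nu T u g y by exact: exp_density_ge0.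
have md g := measurable_exp_density nu T u g.
rewrite -subr_le0 -ler_expR expR0.
(* Convexity of [B] without Hölder: the density at [g2] times [expR (B g2 - c)] is the weighted
   geometric mean of the other two, hence at most their arithmetic mean; integrating three
   probability densities gives the bound. *)
apply: (@le1_of_density_mixture _ _ _ nu (exp_density nu T u g1)
  (exp_density nu T u g2) (exp_density nu T u g3) _ t (d0 g1) (md g1)
  (integral_exp_density I1) (d0 g2) (md g2) (integral_exp_density I2)
  (d0 g3) (md g3) (integral_exp_density I3) (expR_ge0 _) t0 t1).
move=> y; rewrite !dE -expRD ut /c; move: (B g1) (B g2) (B g3) (u g1) (u g3) (T y).
move=> B1 B2 B3 u1 u3 Ty; apply: le_trans (expR_convex _ _ t0 t1).
by rewrite ler_expR le_eqVlt; apply/orP; left; apply/eqP; ring.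
Qed.

Lemma log_partition_quasiconvex x y z : I x -> I y -> I z -> x <= y <= z ->
  B y <= Num.max (B x) (B z).
Proof.
move=> Ix Iy Iz xyz; have [t [t0 t1 _ h]] := exp_density_intermediate Ix Iy Iz xyz.
apply: (le_trans h); rewrite le_max; case: (leP (B x) (B z)) => h'; apply/orP.
  by right; nra.
by left; nra.
Qed.

Lemma natural_parameter_quasiconvex x y z : I x -> I y -> I z -> x <= y <= z ->
  u y <= Num.max (u x) (u z).
Proof.
move=> Ix Iy Iz xyz; have [t [t0 t1 -> _]] := exp_density_intermediate Ix Iy Iz xyz.
rewrite le_max; case: (leP (u x) (u z)) => h'; apply/orP.
  by right; nra.
by left; nra.
Qed.

(** The log-density at [x2] is at least a convex combination of those at [x1] and [x3], hence at
    least the smaller of them. *)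
Lemma exp_density_quasiconcave x1 x2 x3 y : I x1 -> I x2 -> I x3 -> x1 <= x2 <= x3 ->
  Num.min (exp_density nu T u x1 y) (exp_density nu T u x3 y) <= exp_density nu T u x2 y.
Proof.
move=> I1 I2 I3 x123; have [t [t0 t1 ut Bt]] := exp_density_intermediate I1 I2 I3 x123.
have dE g : exp_density nu T u g y = expR (u g * T y - B g) by [].
rewrite (dE x1) (dE x2) (dE x3) ut.
move: (B x1) (B x2) (B x3) (u x1) (u x3) (T y) Bt.
move=> B1 B2 B3 u1 u3 Ty Bt; rewrite ge_min !ler_expR.
case: (leP (u1 * Ty - B1) (u3 * Ty - B3)) => h; apply/orP.
  by left; nra.
by right; nra.
Qed.

Lemma psi_exp_density_quasiconcave a y x1 x2 x3 : 0 < a -> I x1 -> I x2 -> I x3 ->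
  x1 <= x2 <= x3 ->
  Num.min (psi_sqrt_ratio (exp_density nu T u x1 y) a)
          (psi_sqrt_ratio (exp_density nu T u x3 y) a) <=
    psi_sqrt_ratio (exp_density nu T u x2 y) a.
Proof.
move=> a0 I1 I2 I3 x123; have := exp_density_quasiconcave y I1 I2 I3 x123.
have := exp_density_ge0 nu T u x1 y; have := exp_density_ge0 nu T u x3 y.
move: (exp_density nu T u x1 y) (exp_density nu T u x2 y) (exp_density nu T u x3 y).
move=> r1 r2 r3 r30 r10; rewrite !ge_min => /orP[] h; apply/orP; [left|right];
  exact: le_psi_sqrt_ratio.
Qed.

(** Joint measurability reduces to that of [u] and [B] composed with [g], which quasiconvexity on
    [I] provides. *)
Lemma measurable_exp_density_comp dW (W : measurableType dW) (g : W -> R) :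
  measurable_fun setT g -> (forall w, I (g w)) ->
  measurable_fun setT (fun z : W * Y => exp_density nu T u (g z.1) z.2).
Proof.
move=> mg Ig; apply: (@measurableT_comp _ _ _ _ _ _ (@expR R)) => //.
have mug : measurable_fun setT (fun w => u (g w)).
  by apply: (measurable_quasiconvex_comp itvI natural_parameter_quasiconvex mg).
have mBg : measurable_fun setT (fun w => B (g w)).
  by apply: (measurable_quasiconvex_comp itvI log_partition_quasiconvex mg).
apply: measurable_funB; last exact: (measurableT_comp mBg).
apply: measurable_funM; first exact: (measurableT_comp mug).
exact: measurableT_comp.
Qed.

End exponential_family_facts.

Section risk_inequality.
Context dW (TW : measurableType dW) dY (TY : measurableType dY) (R : realType).
Variables (nu : {measure set TY -> \bar R}) (T : {mfun TY >-> R}) (u : R -> R).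
Variables (I : set R) (itvI : is_interval I).
Hypothesis monou : (forall x y, I x -> I y -> x < y -> u x < u y) \/
           (forall x y, I x -> I y -> x < y -> u y < u x).
Hypothesis finB : forall g, I g -> log_partition nu T u g \is a fin_num.

Definition contrast (g g' : TW -> R) (z : TW * TY) : R :=
  psi_sqrt_ratio (exp_density nu T u (g' z.1) z.2) (exp_density nu T u (g z.1) z.2).

Lemma contrast_le1 g g' z : `|contrast g g' z| <= 1.
Proof. by rewrite ler_norml psi_sqrt_ratio_bound// exp_density_gt0. Qed.

Lemma measurable_contrast g g' : measurable_fun setT g -> (forall w, I (g w)) ->
  measurable_fun setT g' -> (forall w, I (g' w)) -> measurable_fun setT (contrast g g').
Proof.
move=> mg Ig mg' Ig'; apply: measurable_psi_sqrt_ratio.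
- by move=> z; exact: exp_density_gt0.
- exact: (measurable_exp_density_comp itvI monou finB mg' Ig').
- exact: (measurable_exp_density_comp itvI monou finB mg Ig).
Qed.

(** [hellinger_bound] holds for each covariate value [w]; it is integrated over [w], with the
    contrast term disintegrated and the Hellinger terms handled as lower integrals. *)
Lemma risk_inequality (K : TW -> probability TY R) (p : probability TW R)
    (mu : probability (TW * TY)%type R) (g g' : TW -> R) :
  hellinger_measurable K ->
  (forall A B, measurable A -> measurable B ->
    mu (A `*` B) = \int[p]_(w in A) K w B)%E ->
  measurable_fun setT g -> (forall w, I (g w)) ->
  measurable_fun setT g' -> (forall w, I (g' w)) ->
  ((\int[mu]_z (contrast g g' z + contrast g g' z ^+ 2 / 10))%:E +
     (47 / 250)%:E * \int[p]_w (hellinger (K w) (exp_prob nu T u (g' w)) ^+ 2)%:E <=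
   14%:E * \int[p]_w (hellinger (K w) (exp_prob nu T u (g w)) ^+ 2)%:E)%E.
Proof.
move=> hK muE mg Ig mg' Ig'.
have mK B : measurable B -> measurable_fun setT (fun w => K w B).
  exact: hellinger_measurable_kernel.
have mf := measurable_contrast mg Ig mg' Ig'.
have f1 := contrast_le1 g g'.
set f := contrast g g' in mf f1 *.
pose F z := f z + f z ^+ 2 / 10.
have mF : measurable_fun setT F.
  by apply: measurable_funD => //; apply: measurable_funM => //; exact: measurable_funX.
have F2 z : `|F z| <= 2.
  by have := f1 z; rewrite /F !ler_norml => /andP[? ?]; nra.
pose phi w := \int[K w]_y F (w, y).
have mFw w : measurable_fun setT (fun y => F (w, y)) by exact: measurable_fun_pair2.
have phiE w : (\int[K w]_y (F (w, y) + 2)%:E = (phi w + 2)%:E)%E.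
  by rewrite (integral_addr_cst _ (mFw w)).
have F20 z : (0 <= (F z + 2)%:E)%E.
  by rewrite lee_fin; have := F2 z; rewrite ler_norml => /andP[? _]; lra.
have mF2 : measurable_fun setT (fun z => (F z + 2)%:E).
  by apply/measurable_EFinP; exact: measurable_funD.
have mphi : measurable_fun setT phi.
  have := measurable_cond_integral mK F20 mF2.
  under eq_fun do rewrite phiE.
  move=> /measurable_EFinP m2.
  rewrite (_ : phi = (fun w => (phi w + 2) - 2)); last by apply/funext => w; rewrite addrK.
  exact: measurable_funB.
have phi2 w : `|phi w| <= 2.
  exact: (normr_Rintegral_le (K w) (mFw w) (fun y => F2 (w, y))).
(* Disintegration is stated for nonnegative integrands, so it is applied to [F + 2]. *)
have -> : \int[mu]_z F z = \int[p]_w phi w.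
  have := integral_disintegration mK muE F20 mF2.
  rewrite (integral_addr_cst _ mF F2).
  under [in RHS]eq_integral do rewrite phiE.
  rewrite (integral_addr_cst _ mphi phi2) => -[]; exact: addIr.
apply: (@le_integral_lower _ _ _ p phi
  (fun w => hellinger (K w) (exp_prob nu T u (g' w)) ^+ 2)
  (fun w => hellinger (K w) (exp_prob nu T u (g w)) ^+ 2) 2 (47 / 250) 14 mphi phi2) => //.
- by move=> w; exact: sqr_ge0.
- by move=> w; exact: sqr_ge0.
move=> w.
apply: (@hellinger_bound _ _ _ nu (K w) (exp_prob nu T u (g w)) (exp_prob nu T u (g' w))
  (exp_density nu T u (g w)) (exp_density nu T u (g' w)) (fun y => f (w, y))
  (exp_density_ge0 nu T u (g w)) (measurable_exp_density nu T u (g w))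
  (exp_density_ge0 nu T u (g' w)) (measurable_exp_density nu T u (g' w))).
- by move=> y; exact: exp_density_gt0.
- by move=> A mA; rewrite exp_probE// finB.
- by move=> A mA; rewrite exp_probE// finB.
- by [].
Qed.

End risk_inequality.

(** * The estimator *)

Lemma psi_sqrt_ratioC (R : realType) (a b : R) : 0 < a -> 0 < b ->
  psi_sqrt_ratio a b = - psi_sqrt_ratio b a.
Proof.
move=> a0 b0; rewrite !psi_sqrt_ratioE//.
have -> : b / a = (a / b)^-1 by rewrite invf_div.
rewrite sqrtrV ?divr_ge0 ?ltW//.
have : 0 < Num.sqrt (a / b) by rewrite sqrtr_gt0 divr_gt0.
move: (Num.sqrt _) => t t0.
have t1 : t + 1 != 0 by rewrite gt_eqF// addr_gt0.
have t1' : 1 + t != 0 by rewrite addrC.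
by field; rewrite t1' gt_eqF.
Qed.

Section estimator.
Context (R : realType) (W Y : Type) (r : R -> Y -> R) (n : nat).
Context (M : Type) (Gamma : M -> set (W -> R)) (V : M -> nat) (Delta : M -> R).
Hypothesis r_gt0 : forall g y, 0 < r g y.
Hypothesis Delta0 : forall m, 0 <= Delta m.

Local Notation pen := (penalty n Gamma V Delta).
Local Notation test := (test_statistic r).

Lemma test_statisticE (x : n.-tuple (W * Y)) g g' : test x g g' =
  \sum_(i < n) psi_sqrt_ratio (r (g' (tnth x i).1) (tnth x i).2)
                              (r (g (tnth x i).1) (tnth x i).2).
Proof. by apply: eq_bigr => i _; case: (tnth x i). Qed.

Lemma test_statisticC (x : n.-tuple (W * Y)) g g' : test x g' g = - test x g g'.
Proof.
rewrite !test_statisticE -sumrN; apply: eq_bigr => i _.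
exact: psi_sqrt_ratioC.
Qed.

Lemma dimension_term_ge0 (v : nat) : 0 <= dimension_term R n v.
Proof.
apply: mulr_ge0; first by apply: mulr_ge0 (ler0n _ _); apply: exprn_ge0; exact: ler0n.
by apply: addr_ge0; [exact: divr_ge0 (ler0n _ _) (ler0n _ _)|rewrite le_max lexx].
Qed.

Lemma penalty_le m g : Gamma m g ->
  (pen g <= (10 ^+ 2 * (dimension_term R n (V m) + 47 / 10 * Delta m))%:E)%E.
Proof.
move=> mg; rewrite EFinM /penalty; apply: lee_wpmul2l.
  by rewrite lee_fin; apply: exprn_ge0; exact: ler0n.
by apply: ereal_inf_lbound; exists m.
Qed.

Lemma le_penalty g (z : R) :
  (forall m, Gamma m g -> z <= 10 ^+ 2 * (dimension_term R n (V m) + 47 / 10 * Delta m)) ->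
  (z%:E <= pen g)%E.
Proof.
have t0 : (0 : R) < 10 ^+ 2 by apply: exprn_gt0; exact: ltr0n.
move=> h; rewrite /penalty -lee_pdivrMl; last exact: t0.
apply/ereal_infP => _ [m mg <-].
by rewrite lee_fin ler_pdivrMl; [exact: h|exact: t0].
Qed.

Lemma penalty_fin_num g : models Gamma g -> pen g \is a fin_num.
Proof.
move=> [m _ mg]; rewrite ge0_fin_numE.
  by rewrite (le_lt_trans (penalty_le mg))// ltry.
apply: le_penalty => m' _; apply: mulr_ge0; first by apply: exprn_ge0; exact: ler0n.
apply: addr_ge0; first exact: dimension_term_ge0.
by apply: mulr_ge0 (Delta0 m'); exact: divr_ge0 (ler0n _ _) (ler0n _ _).
Qed.

(* The first hypothesis bounds the test of gbar against any competitor; applied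
   to the estimator itself, with the sign of the test reversed, it controls the
   risk of the estimator. *)
Lemma estimator_bound (x : n.-tuple (W * Y)) gbar ghat m (l : (W -> R) -> \bar R)
    (c C e : R) : 0 < c -> 0 <= C -> (forall g, 0 <= l g)%E ->
  Gamma m gbar -> estimators r Gamma V Delta x ghat ->
  (forall g, models Gamma g ->
    (test x gbar g)%:E + c%:E * l g <= C%:E * l gbar + pen g + e%:E)%E ->
  (c%:E * l ghat <= (2 * C)%:E * l gbar +
    (2 * (10 ^+ 2 * (dimension_term R n (V m) + 47 / 10 * Delta m)) + 2 * e + 1)%:E)%E.
Proof.
move=> c0 C0 l0 mgbar [mghat ups] h.
have [goo|] := eqVneq (C%:E * l gbar)%E +oo%E.
  by rewrite EFinM -muleA goo gt0_muley ?lte_fin// addye// leey.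
rewrite -ltey -ge0_fin_numE ?mule_ge0 ?lee_fin// => Cfin.
move: h ups; rewrite EFinM -muleA; move: Cfin; move: (C%:E * l gbar)%E => [L||]// _ h ups.
have mbar : models Gamma gbar by exists m.
have pbar := penalty_fin_num mbar; have phat := penalty_fin_num mghat.
have pbar_le := penalty_le mgbar.
have up1 : (upsilon r Gamma V Delta x gbar <= (L + e)%:E + pen gbar)%E.
  rewrite /upsilon leeD2r//; apply: ge_ereal_sup => _ [g mg <-].
  have pg := penalty_fin_num mg; have := h g mg.
  have : (0 <= c%:E * l g)%E by rewrite mule_ge0// lee_fin ltW.
  move: pg; move: (pen g) (c%:E * l g)%E => [p||]// [q||]// _.
  by rewrite !lee_fin; lra.
have up2 : ((test x ghat gbar)%:E - pen gbar + pen ghat <=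
    upsilon r Gamma V Delta x ghat)%E.
  by rewrite /upsilon leeD2r//; apply: ereal_sup_ubound; exists gbar.
have inf_le : (ereal_inf [set upsilon r Gamma V Delta x g | g in models Gamma] <=
    upsilon r Gamma V Delta x gbar)%E.
  by apply: ereal_inf_lbound; exists gbar.
(* Adding this to [h] at [ghat], the test statistics cancel by antisymmetry, and so does the penalty
   of [ghat]. *)
have := le_trans up2 (le_trans ups (leeD2r 1%E (le_trans inf_le up1))).
have := h _ mghat; rewrite test_statisticC.
move: pbar phat pbar_le; move: (pen gbar) (pen ghat) (test x gbar ghat) => [p||]// [q||]// t _ _.
move: (c%:E * l ghat)%E => [a||].
- by rewrite !lee_fin; lra.
- by [].
- by move=> *; exact: leNye.
Qed.

End estimator.

Lemma countable_enum (T : Type) (A : set T) : countable A -> A !=set0 ->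
  exists f : nat -> T, range f = A.
Proof.
move=> /pfcard_geP[->|[f]]; first by case.
by move=> _; exists f; exact: image_eq.
Qed.

Lemma measurable_bigcup_countable d (T : measurableType d) (I : Type) (A : set I)
    (F : I -> set T) : countable A -> (forall i, A i -> measurable (F i)) ->
  measurable (\bigcup_(i in A) F i).
Proof.
move=> cA mF; have [->|/set0P A0] := eqVneq A set0; first by rewrite bigcup_set0.
have [f fA] := countable_enum cA A0.
rewrite (_ : \bigcup_(i in A) F i = \bigcup_k F (f k)).
  by apply: bigcupT_measurable => k; apply: mF; rewrite -fA; exists k.
apply/seteqP; split => [t [i Ai Ft]|t [k _ Ft]].
  by move: Ai Ft; rewrite -fA => -[k _ <-] Ft; exists k.
by exists (f k) => //; rewrite -fA; exists k.
Qed.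

(** Countable subadditivity along the codes of [M] in [nat]; codes of no element receive the empty
    set and mass 0. *)
Lemma measure_bigcup_le_esum d (T : measurableType d) (R : realType)
    (mu : {measure set T -> \bar R}) (M : countType) (A : M -> set T) (a : M -> \bar R)
    (c : R) : 0 <= c -> (forall m, 0 <= a m)%E ->
  (forall m, measurable (A m)) -> (forall m, mu (A m) <= c%:E * a m)%E ->
  (mu (\bigcup_m A m) <= c%:E * \esum_(m in [set: M]) a m)%E.
Proof.
move=> c0 a0 mA muA.
pose A' k := if choice.pickle_inv k is Some m then A m else set0.
pose a' k := if choice.pickle_inv k is Some m then a m else 0%E.
have a'0 k : (0 <= a' k)%E by rewrite /a'; case: choice.pickle_inv.
have mA' k : measurable (A' k) by rewrite /A'; case: choice.pickle_inv.
have AA' : \bigcup_m A m = \bigcup_k A' k.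
  apply/seteqP; split => [t [m _ Amt]|t [k _]].
    by exists (choice.pickle m) => //; rewrite /A' choice.pickleK_inv.
  by rewrite /A'; case: choice.pickle_inv => // m Amt; exists m.
have -> : (\esum_(m in [set: M]) a m = \sum_(0 <= k <oo) a' k)%E.
  rewrite nneseries_esumT//.
  have -> : (\esum_(m in [set: M]) a m = \esum_(k in range (@choice.pickle M)) a' k)%E.
    rewrite (@reindex_esum _ _ _ [set: M] _ (@choice.pickle M) a').
      by apply: eq_esum => m _; rewrite /a' choice.pickleK_inv.
    split => [m _|m m' _ _|k [m _ <-]]; [by exists m| |by exists m].
    exact: (pcan_inj (@choice.pickleK M)).
  rewrite esum_mkcond; apply: eq_esum => k _.
  case: ifPn => // kp; rewrite /a'; case e: (choice.pickle_inv k) => [m|//].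
  exfalso; move/negP: kp; apply; rewrite inE; exists m => //.
  by have := @choice.pickle_invK M k; rewrite /ocancel e.
rewrite AA'; apply: (@le_trans _ _ (\sum_(0 <= k <oo) mu (A' k))%E).
  by apply: measure_sigma_subadditive => //; exact: bigcupT_measurable.
rewrite -nneseriesZl//; apply: lee_nneseries => // k _.
by rewrite /A' /a'; case: choice.pickle_inv => [m|]//; rewrite measure0 mule0.
Qed.

(** * Deviation bounds over a countable model *)

Section deviation_models.
Context dO (Omega : measurableType dO) (R : realType) (P : probability Omega R).
Context dW (TW : measurableType dW) dY (TY : measurableType dY).
Variables (X : nat -> {mfun Omega >-> (TW * TY)%type}) (n : nat).
Hypothesis indX : mutually_independent P (fun i : 'I_n => X i : Omega -> (TW * TY)%type).
Variables (nu : {measure set TY -> \bar R}) (T : {mfun TY >-> R}) (u : R -> R).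
Variables (I : set R) (itvI : is_interval I).
Hypothesis monou : (forall x y, I x -> I y -> x < y -> u x < u y) \/
           (forall x y, I x -> I y -> x < y -> u y < u x).
Hypothesis finB : forall g, I g -> log_partition nu T u g \is a fin_num.

Variable gbar : TW -> R.
Hypotheses (mgbar : measurable_fun setT gbar) (Igbar : forall w, I (gbar w)).

Definition large_deviation (G : set (TW -> R)) (z : R) : set Omega :=
  \bigcup_(g in G) [set omega | z < deviation P X n (contrast nu T u gbar g) omega].

Lemma measurable_large_deviation G z : countable G ->
  (forall g, G g -> measurable_fun setT g /\ forall w, I (g w)) ->
  measurable (large_deviation G z).
Proof.
move=> cG mG; apply: measurable_bigcup_countable => // g /mG[mg Ig].
have mc := measurable_contrast itvI monou finB mgbar Igbar mg Ig.
exact: measurable_deviation_gt.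
Qed.

(** The model is enumerated as a sequence, so that [deviation_seq] applies with the entropy from
    [vc_summax_le], the contrast being a quasiconcave function [phi] of the value of [g]. *)
Lemma large_deviation_le (G : set (TW -> R)) (V : nat) (x : R) : countable G ->
  (forall g, G g -> measurable_fun setT g /\ forall w, I (g w)) ->
  vc_subgraph G V -> (1 <= V)%N ->
  (P (large_deviation G (100 * (vc_entropy R V n + x))) <= (expR (- x))%:E)%E.
Proof.
move=> cG mG vcG V1; rewrite /large_deviation.
have [->|/set0P G0] := eqVneq G set0.
  by rewrite bigcup_set0 measure0 lee_fin expR_ge0.
have [f fG] := countable_enum cG G0.
have Gf k : G (f k) by rewrite -fG; exists k.
have mc k : measurable_fun setT (contrast nu T u gbar (f k)).
  by have [mg Ig] := mG _ (Gf k); exact: (measurable_contrast itvI monou finB).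
rewrite (_ : \bigcup_(g in G) _ = [set omega | exists j,
    100 * (vc_entropy R V n + x) < deviation P X n (contrast nu T u gbar (f j)) omega]); last first.
  apply/seteqP; split => omega.
    by move=> [g]; rewrite -fG => -[j _ <-] h; exists j.
  by move=> [j h]; exists (f j).
apply: (@deviation_seq _ _ _ P _ _ X n indX (fun k => contrast nu T u gbar (f k))
  (vc_entropy R V n) x mc) => [j z|N zs zsn]; first exact: contrast_le1.
pose phi (z : TW * TY) (g : R) :=
  psi_sqrt_ratio (exp_density nu T u g z.2) (exp_density nu T u (gbar z.1) z.2).
apply: (@vc_summax_le R TW (TW * TY)%type G V n I fst phi vcG V1 _ _ _ 'I_N
  (fun j => f j) zs _ zsn).
- by move=> g /mG[].
- by move=> z y _; apply: psi_sqrt_ratio_bound; exact: exp_density_gt0.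
- move=> z x1 x2 x3 I1 I2 I3 x123.
  by apply: (psi_exp_density_quasiconcave monou finB) I1 I2 I3 x123; exact: exp_density_gt0.
- by move=> j; exact: Gf.
Qed.

End deviation_models.

(** A finite infimum is approached by the thresholds [v + 1 / (k + 1)], each above some element of
    [S]; their events decrease to the event of the infimum. *)
Lemma probability_le_ereal_inf d (T : measurableType d) (R : realType)
    (P : probability T R) (L : T -> \bar R) (S : set (\bar R)) (q : \bar R) :
  (forall v, measurable [set t | L t <= v]%E) -> (forall v, S v -> 0 <= v)%E ->
  (q <= 1)%E -> (forall v, S v -> q <= P [set t | L t <= v])%E ->
  (q <= P [set t | L t <= ereal_inf S])%E.
Proof.
move=> mL S0 q1 hq.
have inf0 : (0 <= ereal_inf S)%E by apply/ereal_infP.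
move: inf0; case e : (ereal_inf S) => [v||]// v0; last first.
  rewrite (_ : [set t | _] = setT) ?probability_setT//.
  by apply/seteqP; split => // t _ /=; exact: leey.
pose E k := [set t | L t <= (v + k.+1%:R^-1)%:E]%E.
have vk k : v < v + k.+1%:R^-1 by rewrite ltrDl invr_gt0 ltr0n.
have qE k : (q <= P (E k))%E.
  have : (ereal_inf S < (v + k.+1%:R^-1)%:E)%E by rewrite e lte_fin.
  move=> /ereal_inf_lt[s Ss sv]; apply: (le_trans (hq s Ss)).
  apply: le_measure; rewrite ?inE; [exact: mL|exact: mL|].
  by move=> t /= ts; exact: le_trans ts (ltW sv).
have -> : [set t | L t <= v%:E]%E = \bigcap_k E k.
  apply/seteqP; split => t /= h.
    by move=> k _; apply: (le_trans h); rewrite lee_fin ltW.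
  apply/lee_addgt0Pr => eps eps0; have := h (Num.truncn eps^-1) I.
  move=> /le_trans; apply; rewrite -EFinD lee_fin lerD2l.
  rewrite -[leRHS]invrK lef_pV2 ?posrE ?invr_gt0 ?ltr0n//.
  have i0 : 0 <= eps^-1 by rewrite invr_ge0 ltW.
  by have /andP[_ /ltW] := truncn_itv i0.
have cvE : P (E k) @[k --> \oo] --> P (\bigcap_k E k).
  apply: nonincreasing_cvg_mu => //.
  - by rewrite (le_lt_trans (probability_le1 _ _)) ?ltry//; exact: mL.
  - by move=> k; exact: mL.
  - by apply: bigcapT_measurable => k; exact: mL.
  move=> j k jk; apply/subsetPset => t /= /le_trans; apply.
  by rewrite lee_fin lerD2l lef_pV2 ?posrE ?ltr0n// ler_nat ltnS.
rewrite -(cvg_lim _ cvE)//; apply: lime_ge; first by apply/cvg_ex; eexists; exact: cvE.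
by near=> k; exact: qE.
Unshelve. all: by end_near. Qed.

Section pair_variable.
Context dO (Omega : measurableType dO) (R : realType) (P : probability Omega R).
Context dW (TW : measurableType dW) dY (TY : measurableType dY).
Variables (W : {RV P >-> TW}) (Y : {RV P >-> TY}).

Definition pair_variable (omega : Omega) : TW * TY := (W omega, Y omega).

Let measurable_pair_variable : measurable_fun setT pair_variable.
Proof. exact: measurable_fun_pair. Qed.

HB.instance Definition _ :=
  isMeasurableFun.Build _ _ _ _ pair_variable measurable_pair_variable.

Lemma pair_variable_law (K : TW -> probability TY R) A B :
  conditional_distribution Y W K -> measurable A -> measurable B ->
  distribution P pair_variable (A `*` B) = (\int[distribution P W]_(w in A) K w B)%E.
Proof. by move=> cond mA mB; rewrite -cond. Qed.

End pair_variable.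

(** * The oracle inequality *)

Section oracle.
Context dO (Omega : measurableType dO) (R : realType) (P : probability Omega R).
Context dW (TW : measurableType dW) dY (TY : measurableType dY) (n : nat).
Variables (W : 'I_n -> {RV P >-> TW}) (Y : 'I_n -> {RV P >-> TY}).
Hypothesis n0 : (0 < n)%N.
Hypothesis indepX : mutually_independent P (fun i omega => (W i omega, Y i omega)).
Variable Rstar : 'I_n -> TW -> probability TY R.
Hypothesis mRstar : forall i, hellinger_measurable (Rstar i).
Hypothesis condY : forall i, conditional_distribution (Y i) (W i) (Rstar i).
Variables (nu : {measure set TY -> \bar R}) (T : {mfun TY >-> R}) (u : R -> R).
Variables (I : set R) (itvI : is_interval I).
Hypothesis monou : (forall x y, I x -> I y -> x < y -> u x < u y) \/
           (forall x y, I x -> I y -> x < y -> u y < u x).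
Hypothesis finB : forall g, I g -> log_partition nu T u g \is a fin_num.

Definition family_loss (g : TW -> R) : \bar R :=
  loss (fun i => distribution P (W i) : probability TW R) Rstar
    (fun _ w => exp_prob nu T u (g w)).

Let integral_hellinger_ge0 i (g : TW -> R) :
  (0 <= \int[distribution P (W i)]_w
    ((hellinger (Rstar i w) (exp_prob nu T u (g w))) ^+ 2)%:E)%E.
Proof. by apply: integral_ge0 => w _; rewrite lee_fin sqr_ge0. Qed.

Lemma family_loss_ge0 g : (0 <= family_loss g)%E.
Proof. by apply: sume_ge0 => i _; exact: integral_hellinger_ge0. Qed.

Lemma family_loss_inequality g g' :
  measurable_fun setT g -> (forall w, I (g w)) ->
  measurable_fun setT g' -> (forall w, I (g' w)) ->
  ((\sum_(i < n) \int[distribution P (pair_variable (W i) (Y i))]_z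
      (contrast nu T u g g' z + contrast nu T u g g' z ^+ 2 / 10))%:E +
    (47 / 250)%:E * family_loss g' <= 14%:E * family_loss g)%E.
Proof.
move=> mg Ig mg' Ig'.
pose U i := \int[distribution P (pair_variable (W i) (Y i))]_z
  (contrast nu T u g g' z + contrast nu T u g g' z ^+ 2 / 10).
have -> : (\sum_(i < n) \int[distribution P (pair_variable (W i) (Y i))]_z
    (contrast nu T u g g' z + contrast nu T u g g' z ^+ 2 / 10))%:E =
    (\sum_(i < n) (U i)%:E)%E by rewrite sumEFin.
rewrite /family_loss /loss ge0_sume_distrr; last by move=> i _; exact: integral_hellinger_ge0.
rewrite ge0_sume_distrr; last by move=> i _; exact: integral_hellinger_ge0.
rewrite -big_split /=.
apply: lee_sum => i _.
apply: (risk_inequality itvI monou finB (mRstar i) _ mg Ig mg' Ig').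
by move=> A B mA mB; exact: pair_variable_law.
Qed.

Variables (M : countType) (Gammabar Gamma : M -> set (TW -> R)).
Variables (V : M -> nat) (Delta : M -> R).
Hypothesis mGammabar : forall m g, Gammabar m g ->
  measurable_fun setT g /\ forall w, I (g w).
Hypothesis V1 : forall m, (1 <= V m)%N.
Hypothesis vcGammabar : forall m, vc_subgraph (Gammabar m) (V m).
Hypothesis subGamma : forall m, Gamma m `<=` Gammabar m.
Hypothesis countGamma : forall m, countable (Gamma m).
Hypothesis Delta0 : forall m, 0 <= Delta m.
Variable ghat : n.-tuple (TW * TY) -> TW -> R.
Hypothesis ghatP : forall x, estimators (exp_density nu T u) Gamma V Delta x (ghat x).
Hypothesis mghat : forall g, models Gamma g -> measurable (ghat @^-1` [set g]).

(** The deviation bounds use sequences indexed by [nat]; indices beyond the sample repeat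
    observation 0. *)
Let X k := pair_variable (W (insubd (Ordinal n0) k)) (Y (insubd (Ordinal n0) k)).
Let Xt omega := [tuple (W i omega, Y i omega) | i < n].

Let XE (i : 'I_n) : X i = pair_variable (W i) (Y i).
Proof. by rewrite /X valKd. Qed.

Let indX : mutually_independent P (fun i : 'I_n => X i : Omega -> (TW * TY)%type).
Proof. by under eq_fun do rewrite XE; exact: indepX. Qed.

Let mGamma m g : Gamma m g -> measurable_fun setT g /\ forall w, I (g w).
Proof. by move=> /subGamma /mGammabar. Qed.

(** The estimator takes countably many values, so the event is a countable union of level sets of
    [ghat]. *)
Lemma measurable_loss_ghat v : measurable [set omega | family_loss (ghat (Xt omega)) <= v]%E.
Proof.
have mXt : measurable_fun setT Xt.
  apply/measurable_fun_tnthP => i.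
  rewrite (_ : _ \o _ = pair_variable (W i) (Y i))//; apply/funext => omega /=.
  by rewrite tnth_mktuple.
rewrite (_ : [set omega | _] = \bigcup_(g in models Gamma `&` [set g | family_loss g <= v]%E)
    (Xt @^-1` (ghat @^-1` [set g]))); last first.
  apply/seteqP; split => [omega /= lv|omega [g [_ gv] /= gE]]; last by rewrite gE.
  by exists (ghat (Xt omega)) => //; split => //; have [] := ghatP (Xt omega).
apply: measurable_bigcup_countable => [|g [mg _]].
  apply: (sub_countable (subset_card_le (@subIsetl _ _ _))).
  by apply: bigcup_countable => // m _; exact: countGamma.
by rewrite -[X in measurable X]setTI; apply: mXt => //; exact: mghat.
Qed.

Local Notation Xi m := (dimension_term R n (V m) / (47 / 10) + Delta m).
Let c2 : R := 5 * 10 ^+ 3 + 132 / 10.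

(** Adding [Delta m] to the level gives model [m] the probability budget [expR (- Delta m - xi)],
    summing to [Sigma * expR (- xi)]. *)
Let bad gbar (xi : R) := \bigcup_m
  large_deviation P X n nu T u gbar (Gamma m) (100 * (vc_entropy R (V m) n + (Delta m + xi))).

Lemma ghat_bound gbar m0 xi omega : 0 < xi -> Gamma m0 gbar -> ~ bad gbar xi omega ->
  (family_loss (ghat (Xt omega)) <=
    (1498 / 10)%:E * family_loss gbar + (c2 * (Xi m0 + 149 / 100 + xi))%:E)%E.
Proof.
move=> xi0 mgbar nbad.
have [mg Ig] := mGamma mgbar.
have c0 : (0 : R) < 47 / 250 by lra.
have C0 : (0 : R) <= 14 by lra.
have r0 g y : 0 < exp_density nu T u g y by exact: exp_density_gt0.
have := @estimator_bound R TW TY (exp_density nu T u) n M Gamma V Delta r0 Delta0 (Xt omega)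
  gbar (ghat (Xt omega)) m0 family_loss (47 / 250) 14 (100 * xi) c0 C0 family_loss_ge0
  mgbar (ghatP _).
have hyp g : models Gamma g ->
  ((test_statistic (exp_density nu T u) (Xt omega) gbar g)%:E + (47 / 250)%:E * family_loss g
    <= 14%:E * family_loss gbar + penalty n Gamma V Delta g + (100 * xi)%:E)%E.
  move=> [m1 _ gm1]; have [mg' Ig'] := mGamma gm1.
  set D := deviation P X n (contrast nu T u gbar g) omega.
  have -> : test_statistic (exp_density nu T u) (Xt omega) gbar g = D +
      \sum_(i < n) \int[distribution P (pair_variable (W i) (Y i))]_z
        (contrast nu T u gbar g z + contrast nu T u gbar g z ^+ 2 / 10).
    rewrite test_statisticE -big_split /=; apply: eq_bigr => i _.
    by rewrite /drift /X !valKd tnth_mktuple; exact/esym/subrK.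
  (* Outside [bad], the deviation is controlled in every model containing [g], hence by the infimum
     in the penalty. *)
  have Dpen : ((D - 100 * xi)%:E <= penalty n Gamma V Delta g)%E.
    apply: le_penalty => m gm.
    have : D <= 100 * (vc_entropy R (V m) n + (Delta m + xi)).
      rewrite leNgt; apply/negP => DL; apply: nbad; exists m => //.
      by exists g.
    have := vc_entropy_le R n (V1 m); have := Delta0 m; move: (dimension_term _ _ _) => Dm.
    move: (vc_entropy _ _ _) => Lm.
    lra.
  rewrite EFinD -addeA.
  apply: le_trans (leeD2l _ (family_loss_inequality mg Ig mg' Ig')) _.
  rewrite -addeA [leLHS]addeC; apply: leeD2l.
  by rewrite -leeBlDr.
move=> /(_ hyp).
move: (family_loss_ge0 gbar) (family_loss_ge0 (ghat (Xt omega))).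
have mC : ((1498 / 10)%:E * +oo = +oo :> \bar R)%E.
  by apply: gt0_muley; rewrite lte_fin; lra.
have := dimension_term_ge0 R n (V m0); have := Delta0 m0.
move: (dimension_term R n (V m0)) (Delta m0) => Dm dm dm0 Dm0.
move: (family_loss gbar) (family_loss (ghat _)) => [lb||] [lh||]//; rewrite /c2.
(* Division by [47 / 250] turns 28 into less than 149.8, and the penalty term into [5000 * Xi m0];
   the terms in [xi] and the constant 1 fit within [c2 * (149 / 100 + xi)]. *)
- rewrite !lee_fin; lra.
- have m : ((47 / 250)%:E * +oo = +oo :> \bar R)%E by rewrite gt0_muley// lte_fin.
  by rewrite m.
- by move=> _ _ _; rewrite mC addye//; exact: leey.
- by move=> _ _ _; rewrite mC addye//; exact: leey.
Qed.

Let Sigma := (\esum_(m in [set: M]) (expR (- Delta m))%:E)%E.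

Lemma oracle_probability gbar m0 xi : 0 < xi -> Gamma m0 gbar ->
  (1 - Sigma * (expR (- xi))%:E <= P [set omega | family_loss (ghat (Xt omega)) <=
    (1498 / 10)%:E * family_loss gbar + (c2 * (Xi m0 + 149 / 100 + xi))%:E])%E.
Proof.
move=> xi0 mgbar; have [mg Ig] := mGamma mgbar.
have mld m z : measurable (large_deviation P X n nu T u gbar (Gamma m) z).
  exact: (measurable_large_deviation P X n itvI monou finB mg Ig z (countGamma m) (@mGamma m)).
have mbad : measurable (bad gbar xi).
  by apply: measurable_bigcup_countable => // m _; exact: mld.
have vcGamma m : vc_subgraph (Gamma m) (V m).
  by move=> S cS; have [A AS hA] := vcGammabar cS; exists A => // f /subGamma; exact: hA.
have Pbad : (P (bad gbar xi) <= (expR (- xi))%:E * Sigma)%E.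
  apply: measure_bigcup_le_esum; [exact: expR_ge0|by move=> m; rewrite lee_fin expR_ge0|
    by move=> m; exact: mld|move=> m].
  rewrite -EFinM -expRD (_ : - xi + - Delta m = - (Delta m + xi)); last by ring.
  exact: (large_deviation_le indX itvI monou finB mg Ig _ (countGamma m) (@mGamma m)
    (vcGamma m) (V1 m)).
apply: (@le_trans _ _ (P (~` bad gbar xi))).
  rewrite probability_setC// muleC; apply: leeB => //.
apply: le_measure; rewrite ?inE; [exact: measurableC|exact: measurable_loss_ghat|].
by move=> omega /= nbad; exact: ghat_bound.
Qed.

Lemma oracle_inequality xi : 0 < xi ->
  (1 - Sigma * (expR (- xi))%:E <= P [set omega | family_loss (ghat (Xt omega)) <=
    ereal_inf [set (1498 / 10)%:E * ereal_inf [set family_loss g | g in Gamma m] +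
      (c2 * (Xi m + 149 / 100 + xi))%:E | m in [set: M]]])%E.
Proof.
move=> xi0.
have Sigma0 : (0 <= Sigma)%E by apply: esum_ge0 => m _; rewrite lee_fin expR_ge0.
have c10 : (0 : R) < 1498 / 10 by lra.
have c20 : (0 : R) <= c2.
  by apply: addr_ge0; [apply: mulr_ge0 => //; apply: exprn_ge0|exact: divr_ge0].
have Xi0 m : 0 <= Xi m + 149 / 100 + xi.
  have := Delta0 m; have := dimension_term_ge0 R n (V m); lra.
(* The infimum is taken jointly over [m] and [g]; the nested infima are recovered at the end by
   affine rearrangement. *)
pose S := [set v | exists m, exists2 g, Gamma m g &
  v = ((1498 / 10)%:E * family_loss g + (c2 * (Xi m + 149 / 100 + xi))%:E)%E].
apply: (@le_trans _ _ (P [set omega | family_loss (ghat (Xt omega)) <= ereal_inf S]%E)).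
  apply: probability_le_ereal_inf.
  - exact: measurable_loss_ghat.
  - move=> _ [m [g _ ->]]; apply: adde_ge0; last by rewrite lee_fin mulr_ge0.
    by apply: mule_ge0; [rewrite lee_fin ltW|exact: family_loss_ge0].
  - by rewrite -[leRHS]sube0; apply: leeB => //; rewrite mule_ge0// lee_fin expR_ge0.
  - by move=> _ [m [g mg ->]]; exact: oracle_probability.
apply: le_measure; rewrite ?inE; [exact: measurable_loss_ghat..|].
move=> omega /= /le_trans; apply; apply/ereal_infP => _ [m _ <-].
rewrite -leeBlDr// -lee_pdivrMl//; apply/ereal_infP => _ [g mg <-].
rewrite lee_pdivrMl// leeBlDr//; apply: ereal_inf_lbound.
by exists m, g.
Qed.

End oracle.

Theorem theorem1
  (R : realType)
  (dO dW dY : measure_display)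
  (Omega : measurableType dO) (TW : measurableType dW) (TY : measurableType dY)
  (P : probability Omega R)
  (* observations *)
  (n : nat) (hn : (0 < n)%N)
  (W : 'I_n -> {RV P >-> TW}) (Y : 'I_n -> {RV P >-> TY})
  (indepX : mutually_independent P (fun i omega => (W i omega, Y i omega)))
  (Rstar : 'I_n -> TW -> probability TY R)
  (mRstar : forall i, hellinger_measurable (Rstar i))
  (condY : forall i, conditional_distribution (Y i) (W i) (Rstar i))
  (* exponential family *)
  (I : set R) (itvI : is_interval I) (intI : I° !=set0)
  (mu : {measure set TY -> \bar R})
  (a : TY -> R) (a0 : forall y, 0 <= a y) (ma : measurable_fun setT a)
  (T : {mfun TY >-> R})
  (ncstT : ~ exists c : R, {ae density mu a0 ma, forall y, T y = c})
  (u : R -> R) (cu : {within I, continuous u})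
  (monou : (forall x y, I x -> I y -> x < y -> u x < u y) \/
           (forall x y, I x -> I y -> x < y -> u y < u x))
  (finB : forall g, I g -> log_partition (density mu a0 ma) T u g \is a fin_num)
  (* models *)
  (M : countType)
  (Gammabar Gamma : M -> set (TW -> R)) (V : M -> nat) (Delta : M -> R)
  (mGammabar : forall m g, Gammabar m g ->
     measurable_fun setT g /\ forall w, I (g w))
  (V1 : forall m, (1 <= V m)%N)
  (vcGammabar : forall m, vc_subgraph (Gammabar m) (V m))
  (subGamma : forall m, Gamma m `<=` Gammabar m)
  (countGamma : forall m, countable (Gamma m))
  (Delta0 : forall m, 0 <= Delta m)
  (finSigma : (\esum_(m in [set: M]) (expR (- Delta m))%:E < +oo)%E)
  (* estimator *)
  (ghat : n.-tuple (TW * TY) -> TW -> R)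
  (ghatP : forall x,
     estimators (exp_density (density mu a0 ma) T u) Gamma V Delta x (ghat x))
  (mghat : forall g, models Gamma g -> measurable (ghat @^-1` [set g])) :
  let nu := density mu a0 ma in
  let Sigma := (\esum_(m in [set: M]) (expR (- Delta m))%:E)%E in
  let X omega := [tuple (W i omega, Y i omega) | i < n] in
  let PW i : probability TW R := distribution P (W i) in
  let RR (g : TW -> R) (_ : 'I_n) w := exp_prob nu T u (g w) in
  let Q m := [set RR g | g in Gamma m] in
  let Xi m := dimension_term R n (V m) / (47 / 10) + Delta m in
  let c1 : R := 1498 / 10 in
  let c2 : R := 5 * 10 ^+ 3 + 132 / 10 in (* 5013.2, avoiding a large unary numeral *)
  forall xi : R, 0 < xi ->
  (1 - Sigma * (expR (- xi))%:E <=
   P [set omega | loss PW Rstar (RR (ghat (X omega))) <=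
        ereal_inf [set c1%:E * loss_set PW Rstar (Q m)
                       + (c2 * (Xi m + 149 / 100 + xi))%:E | m in [set: M]]])%E.
Proof.
move=> nu Sigma X PW RR Q Xi c1 c2 xi xi0.
have := @oracle_inequality dO Omega R P dW TW dY TY n W Y hn indepX Rstar mRstar condY
  nu T u I itvI monou finB M Gammabar Gamma V Delta mGammabar V1 vcGammabar subGamma
  countGamma Delta0 ghat ghatP mghat xi xi0.
have -> // : (fun m => c1%:E * loss_set PW Rstar (Q m) + (c2 * (Xi m + 149 / 100 + xi))%:E)%E =
  (fun m => c1%:E * ereal_inf [set family_loss W Rstar nu T u g | g in Gamma m] +
    (c2 * (Xi m + 149 / 100 + xi))%:E)%E.
apply/funext => m; congr (_ * ereal_inf _ + _)%E.
by rewrite /Q image_comp.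
Qed.
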